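(* Let $G$ be a finitely generated discrete group and let $\mathscr{T}$ be $\mathscr{O}$ or $\mathscr{S}^k$ for some $k\in\mathbb{R}_+\cup\{\infty,\omega\}$. If the chain complex $\mathscr{T}\tilde{C}_\bullet(G)$ has a bounded contracting homotopy (bounded linear maps $h_n\colon\mathscr{T}\tilde{C}_n(G)\to\mathscr{T}\tilde{C}_{n+1}(G)$ with $\delta h+h\delta=\mathrm{id}$), then the canonical map $H^n(\mathscr{T}G)\to H^n(G)$ is an isomorphism for all $n\in\mathbb{N}$.
   Context: All vector spaces are real; $\mathbb{R}_+=[0,\infty)$. A bornology on a vector space $V$ is a collection of subsets, called bounded, such that subsets of bounded sets, finite sets, sums $S_1+S_2$ of bounded sets, and $\bigcup_{|t|\le\lambda}tS$ for $S$ bounded and $\lambda\in\mathbb{R}$ are bounded. All bornologies are complete and convex: every bounded subset is contained and bounded in some subspace $V_T$ with a Banach space norm for which $V_T\to V$ is bounded. A linear map is bounded if it maps bounded sets to bounded sets. $G$ carries the word length function $\ell$ for a finite generating set and the left invariant word metric $d(g,h)=\ell(g^{-1}h)$. Put $X=G$ in the following definitions. Function spaces. For $k\in\mathbb{R}_+$ let $\mathscr{S}^k(X)$ be the Banach space of $\phi\colon X\to\mathbb{R}$ with $\|\phi\|^k=\sum_{x}|\phi(x)|(\ell(x)+1)^k<\infty$, with the bornology of norm-bounded subsets. Let $\mathscr{S}^\infty(X)=\bigcap_{k\in\mathbb{N}}\mathscr{S}^k(X)$; a subset is bounded if it is bounded for each norm $\|\cdot\|^k$, $k\in\mathbb{N}$.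 For $\alpha>1$ let $|||\phi|||_\alpha=\sum_x|\phi(x)|\alpha^{\ell(x)}$. Let $\mathscr{O}(X)$ be the space of $\phi$ with $|||\phi|||_\alpha<\infty$ for all $\alpha>1$; a subset is bounded if it is bounded for every $|||\cdot|||_\alpha$. Let $\mathscr{S}^\omega(X)$ be the space of $\phi$ with $|||\phi|||_\alpha<\infty$ for some $\alpha>1$; a subset is bounded if it is bounded for some $|||\cdot|||_\alpha$ with $\alpha>1$. Tempered chain complexes. For $R\in\mathbb{N}$ let $\mathscr{T}C_n(X)_R$ be the space of functions $\phi\colon X^{n+1}\to\mathbb{R}$ such that $\phi(x_0,\dots,x_n)=0$ whenever $d(x_i,x_j)>R$ for some $i,j$ or $x_j=x_{j+1}$ for some $j$, and such that the function $x\mapsto\sum_{x_1,\dots,x_n}|\phi(x,x_1,\dots,x_n)|$ belongs to $\mathscr{T}(X)$. A subset is bounded if the associated set of functions in $\mathscr{T}(X)$ is bounded. Let $\mathscr{T}C_n(X)=\bigcup_R\mathscr{T}C_n(X)_R$, where a subset is bounded if it is contained and bounded in some $\mathscr{T}C_n(X)_R$. The boundary map $\delta\colon\mathscr{T}C_n(X)\to\mathscr{T}C_{n-1}(X)$ is the bounded extension of $\delta(x_0,\dots,x_n)=\sum_{j=0}^n(-1)^j(x_0,\dots,\widehat{x_j},\dots,x_n)$, where a tuple denotes its characteristic function and tuples with two equal consecutive entries are regarded as $0$. The augmentation is $\alpha\colon\mathscr{T}C_0(X)=\mathscr{T}(X)\to\mathbb{R}$, $\alpha(\phi)=\sum_x\phi(x)$.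 The reduced complex $\mathscr{T}\tilde{C}_\bullet(X)$ has $\mathscr{T}\tilde{C}_0(X)=\ker\alpha$ and $\mathscr{T}\tilde{C}_n(X)=\mathscr{T}C_n(X)$ for $n\ge1$, with boundary map $\delta$. Group cohomology. Let $\mathscr{C}^n(G)$ be the space of all functions $G^n\to\mathbb{R}$ ($\mathscr{C}^0(G)=\mathbb{R}$), with coboundary $$\delta\phi(g_1,\dots,g_{n+1})=\phi(g_2,\dots,g_{n+1})+\sum_{j=1}^n(-1)^j\phi(g_1,\dots,g_jg_{j+1},\dots,g_{n+1})+(-1)^{n+1}\phi(g_1,\dots,g_n).$$ Its cohomology is $H^n(G)$. The cohomology $H^n(\mathscr{T}G)$ is that of the subcomplex $\mathscr{C}^\bullet(\mathscr{T}G)\subseteq\mathscr{C}^\bullet(G)$ of cochains $\phi$ satisfying the following growth condition. For $\mathscr{T}=\mathscr{S}^k$ with $k\in\mathbb{R}_+$: $|\phi(g_1,\dots,g_n)|\le C(\ell(g_1)+1)^k\cdots(\ell(g_n)+1)^k$ for some $C>0$. For $\mathscr{T}=\mathscr{S}^\infty$: this holds for some $k\in\mathbb{N}$ and $C>0$. For $\mathscr{T}=\mathscr{S}^\omega$: for every $\alpha>1$ there is $C>0$ with $|\phi(g_1,\dots,g_n)|\le C\alpha^{\ell(g_1)+\dots+\ell(g_n)}$. For $\mathscr{T}=\mathscr{O}$: the latter bound holds for some $\alpha>1$ and $C>0$. The canonical map $H^n(\mathscr{T}G)\to H^n(G)$ is induced by the inclusion of complexes. *)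

(* Defs.v *)
From HB Require Import structures.
From mathcomp Require Import all_boot all_order all_algebra.
From mathcomp Require Import all_classical all_reals all_analysis.

Set Implicit Arguments.
Unset Strict Implicit.
Unset Printing Implicit Defensive.

Import Order.TTheory GRing.Theory Num.Theory.
Local Open Scope classical_set_scope.
Local Open Scope ring_scope.
Local Open Scope quotient_scope.

Section WordLength.
Context (G : groupType) (S : seq G).

Definition spells (w : seq G) (g : G) : bool :=
  all (fun s => (s \in S) || (s^-1 \in S)%g) w && ((\prod_(s <- w) s)%g == g).

Definition generates : Prop := forall g : G, exists w, spells w g.

Definition has_word (g : G) (m : nat) : bool :=
  `[< exists2 w, spells w g & size w = m >].

(* The default value is never used when [S] generates [G]. *)
Definition word_length (g : G) : nat :=
  if pselect (exists m, has_word g m) is left e then ex_minn e else 0%N.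

Definition word_dist (g h : G) : nat := word_length (g^-1 * h)%g.

End WordLength.

Inductive growth (R : realType) : Type :=
| GrowthO
| GrowthS of {nonneg R}
| GrowthSinfty
| GrowthSomega.

Arguments GrowthO {R}.
Arguments GrowthSinfty {R}.
Arguments GrowthSomega {R}.

Section FunctionSpaces.
Context (R : realType) (G : groupType) (S : seq G).
Local Notation ell := (word_length S).

Definition poly_norm (k : R) (f : G -> R) : \bar R :=
  \esum_(x in [set: G]) (`|f x| * (ell x).+1%:R `^ k)%:E.

Definition exp_norm (a : R) (f : G -> R) : \bar R :=
  \esum_(x in [set: G]) (`|f x| * a ^+ ell x)%:E.

Definition fun_space (T : growth R) : set (G -> R) :=
  match T with
  | GrowthO => [set f | forall a, 1 < a -> (exp_norm a f < +oo)%E]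
  | GrowthS k => [set f | (poly_norm k%:num f < +oo)%E]
  | GrowthSinfty => [set f | forall k : nat, (poly_norm k%:R f < +oo)%E]
  | GrowthSomega => [set f | exists2 a, 1 < a & (exp_norm a f < +oo)%E]
  end.

Definition norm_bounded (N : (G -> R) -> \bar R) (F : set (G -> R)) : Prop :=
  exists M : R, forall f, F f -> (N f <= M%:E)%E.

(* A bounded set automatically lies in [fun_space T]. *)
Definition fun_bounded (T : growth R) : set (set (G -> R)) :=
  match T with
  | GrowthO => [set F | forall a, 1 < a -> norm_bounded (exp_norm a) F]
  | GrowthS k => [set F | norm_bounded (poly_norm k%:num) F]
  | GrowthSinfty => [set F | forall k : nat, norm_bounded (poly_norm k%:R) F]
  | GrowthSomega => [set F | exists2 a, 1 < a & norm_bounded (exp_norm a) F]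
  end.

End FunctionSpaces.

Section TemperedChains.
Context (R : realType) (G : groupType) (S : seq G).
Local Notation d := (word_dist S).

Local Notation chain n := (n.+1.-tuple G -> R).

Definition degenerate n (x : n.-tuple G) : bool :=
  ~~ sorted (fun g h => g != h) x.

(* For chains supported in a bounded neighbourhood of the diagonal this is a
   finite sum, because balls in a finitely generated group are finite (finitely
   supported sums over infinite sets are \sum_(_ \in _)). *)
Definition mass n (phi : chain n) : G -> R :=
  fun x => \sum_(y \in [set: n.-tuple G]) `|phi [tuple of x :: y]|.

Definition controlled_chains (T : growth R) n (r : nat) : set (chain n) :=
  [set phi |
    [/\ forall x : n.+1.-tuple G,
          (exists i j, (r < d (tnth x i) (tnth x j))%N) -> phi x = 0,
        forall x : n.+1.-tuple G, degenerate x -> phi x = 0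
      & fun_space S T (mass phi)]].

Definition chains (T : growth R) n : set (chain n) :=
  [set phi | exists r, controlled_chains T r phi].

Definition chains_bounded (T : growth R) n : set (set (chain n)) :=
  [set F | exists2 r, F `<=` @controlled_chains T n r
                    & fun_bounded S T (@mass n @` F)].

Definition face n (j : 'I_n.+2) (x : n.+2.-tuple G) : n.+1.-tuple G :=
  [tuple tnth x (lift j i) | i < n.+1].

(* The characteristic function of [x], or 0 if [x] is degenerate. *)
Definition basis_chain n (x : n.+1.-tuple G) : chain n :=
  fun y => (~~ degenerate x && (y == x))%:R.

Definition bd_basis n (x : n.+2.-tuple G) : chain n :=
  fun y => \sum_(j < n.+2) (-1) ^+ j * basis_chain (face j x) y.

(* On tempered chains only finitely many terms are nonzero for every [y]
   (again because balls are finite), so this is the bounded linear extension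
   of [bd_basis]. *)
Definition bd n (phi : chain n.+1) : chain n :=
  fun y => \sum_(x \in [set: n.+2.-tuple G]) phi x * bd_basis x y.

(* The sum of an absolutely summable family of reals. *)
Definition real_sum (I : choiceType) (f : I -> R) : R :=
  fine (\esum_(i in [set: I]) ((EFin \o f)^\+ i)%E)
  - fine (\esum_(i in [set: I]) ((EFin \o f)^\- i)%E).

Definition augmentation (phi : chain 0) : R := real_sum phi.

Definition reduced_chains (T : growth R) n : set (chain n) :=
  match n return set (chain n) with
  | 0%N => @chains T 0 `&` [set phi | augmentation phi = 0]
  | m.+1 => @chains T m.+1
  end.

Definition reduced_bounded (T : growth R) n : set (set (chain n)) :=
  [set F | F `<=` @reduced_chains T n /\ @chains_bounded T n F].

(* [h] represents a bounded linear map from the subspace [A] to the subspace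
   [B]; its values outside of [A] are irrelevant. *)
Definition bounded_linear_on (V W : lmodType R)
    (A : set V) (bddA : set (set V)) (B : set W) (bddB : set (set W))
    (h : V -> W) : Prop :=
  [/\ forall u, A u -> B (h u),
      forall a u v, A u -> A v -> h (a *: u + v) = a *: h u + h v
    & forall F, bddA F -> bddB (h @` F)].

Definition bounded_contracting_homotopy (T : growth R)
    (h : forall n, chain n -> chain n.+1) : Prop :=
  [/\ forall n, bounded_linear_on (@reduced_chains T n) (@reduced_bounded T n)
                  (@reduced_chains T n.+1) (@reduced_bounded T n.+1) (h n),
      forall phi, @reduced_chains T 0 phi -> bd (h 0%N phi) = phi
    & forall n phi, @reduced_chains T n.+1 phi ->
        bd (h n.+1 phi) + h n (bd phi) = phi].

Definition has_bounded_contracting_homotopy (T : growth R) : Prop :=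
  exists h, bounded_contracting_homotopy T h.

End TemperedChains.

Section QuotientModule.
Context (R : pzRingType) (V : lmodType R) (I : {pred V}) (IP : submod_closed I).

Definition submodule_of of submod_closed I : {pred V} := I.
HB.instance Definition _ :=
  GRing.isSubmodClosed.Build R V (submodule_of IP) IP.

(* The library's [{ideal_quot _}] is only an abelian group. *)
Local Notation Q := {ideal_quot submodule_of IP}.
Definition quotient_module : Type := Q.
HB.instance Definition _ := GRing.Zmodule.on quotient_module.

Definition quot_class (v : V) : quotient_module := \pi_Q v.
Definition quot_repr (x : quotient_module) : V := repr (x : Q).

Lemma quot_reprK : cancel quot_repr quot_class.
Proof. exact: reprK. Qed.

Lemma quot_class_eq u v : (quot_class u = quot_class v) <-> (u - v \in I).
Proof.
have -> : (u - v \in I) = (\pi_Q u == \pi_Q v) by rewrite -Quotient.idealrBE.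
by split=> /eqP.
Qed.

Definition quot_scale (a : R) (x : quotient_module) : quotient_module :=
  quot_class (a *: quot_repr x).

Let quot_scale_class a v : quot_scale a (quot_class v) = quot_class (a *: v).
Proof.
apply/quot_class_eq; rewrite -scalerBr.
have /quot_class_eq := quot_reprK (quot_class v).
exact: (@rpredZ _ _ (submodule_of IP)).
Qed.

Let quot_classD u v : quot_class (u + v) = quot_class u + quot_class v.
Proof. exact: (raddfD (\pi_Q)). Qed.

Let quot_scaleA a b x : quot_scale a (quot_scale b x) = quot_scale (a * b) x.
Proof. by rewrite -[x]quot_reprK !quot_scale_class scalerA. Qed.

Let quot_scale1 : left_id 1 quot_scale.
Proof. by move=> x; rewrite -[x]quot_reprK quot_scale_class scale1r. Qed.

Let quot_scaleDr : right_distributive quot_scale +%R.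
Proof.
move=> a x y; rewrite -[x]quot_reprK -[y]quot_reprK.
by rewrite -quot_classD !quot_scale_class scalerDr quot_classD.
Qed.

Let quot_scaleDl x : {morph quot_scale^~ x : a b / a + b}.
Proof.
by move=> a b; rewrite -[x]quot_reprK !quot_scale_class scalerDl quot_classD.
Qed.

HB.instance Definition _ := GRing.Zmodule_isLmodule.Build R quotient_module
  quot_scaleA quot_scale1 quot_scaleDr quot_scaleDl.

Lemma quot_class_is_linear : linear quot_class.
Proof. by move=> a u v; rewrite quot_classD -quot_scale_class. Qed.

HB.instance Definition _ :=
  GRing.isLinear.Build R V quotient_module *:%R quot_class quot_class_is_linear.

End QuotientModule.

Section Cohomology.
Context (R : realType) (G : groupType).

Definition cochain n : Type := n.-tuple G -> R.
HB.instance Definition _ n := GRing.Lmodule.on (cochain n).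

Definition multiply_at n (j : 'I_n) (g : n.+1.-tuple G) : n.-tuple G :=
  [tuple if (i < j)%N then tnth g (lift ord_max i)
         else if i == j then (tnth g (lift ord_max i) * tnth g (lift ord0 i))%g
         else tnth g (lift ord0 i) | i < n].

Definition cobd n (phi : cochain n) : cochain n.+1 := fun g =>
  phi [tuple tnth g (lift ord0 i) | i < n]
  + \sum_(j < n) (-1) ^+ j.+1 * phi (multiply_at j g)
  + (-1) ^+ n.+1 * phi [tuple tnth g (lift ord_max i) | i < n].

Lemma cobd_is_linear n : linear (@cobd n).
Proof.
move=> a phi psi; apply/funext => g; rewrite /cobd !fctE.
have -> : \sum_(j < n) (-1) ^+ j.+1 *
            (a *: phi (multiply_at j g) + psi (multiply_at j g)) =
          a * (\sum_(j < n) (-1) ^+ j.+1 * phi (multiply_at j g)) +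
          \sum_(j < n) (-1) ^+ j.+1 * psi (multiply_at j g).
  rewrite mulr_sumr -big_split; apply: eq_bigr => j _ /=.
  by rewrite mulrDr /GRing.scale /= mulrCA.
rewrite /GRing.scale /=; set s := \sum_(_ < _) _; set t := \sum_(_ < _) _.
rewrite !mulrDr [(-1) ^+ _ * (a * _)]mulrCA.
by rewrite [a * _ + _ + _]addrACA [LHS]addrACA.
Qed.

HB.instance Definition _ n :=
  GRing.isLinear.Build R (cochain n) (cochain n.+1) *:%R (@cobd n)
    (@cobd_is_linear n).

Definition subcochains : Type := forall n, submodClosed (cochain n).

Section Subcomplex.
Variables (C : subcochains) (n : nat).

Definition cocycles : {pred cochain n} :=
  [pred phi | (phi \in C n) && (cobd phi == 0)].

Lemma cocycles_submod_closed : submod_closed cocycles.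
Proof.
split=> [|a phi psi]; first by rewrite inE rpred0 linear0 eqxx.
rewrite !inE => /andP[Cphi /eqP dphi] /andP[Cpsi /eqP dpsi].
by rewrite rpredD ?rpredZ //= cobd_is_linear dphi dpsi scaler0 addr0.
Qed.

HB.instance Definition _ :=
  GRing.isSubmodClosed.Build R (cochain n) cocycles cocycles_submod_closed.

Definition cocycle : Type := {phi | phi \in cocycles}.
HB.instance Definition _ := SubChoice.on cocycle.
HB.instance Definition _ := [SubChoice_isSubLmodule of cocycle by <:].

End Subcomplex.

Definition cobd_image (C : subcochains) n : set (cochain n) :=
  match n return set (cochain n) with
  | 0%N => [set 0]
  | m.+1 => [set cobd psi | psi in [set` C m]]
  end.

Section Cohomology.
Variables (C : subcochains) (n : nat).

(* The cocycles that are coboundaries; [cohomology C n] is the n-th cohomology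
   of [C] as soon as [C] is stable under [cobd]. *)
Definition coboundaries : {pred cocycle C n} :=
  [pred z | `[< cobd_image C (val z) >]].

Lemma coboundaries_submod_closed : submod_closed coboundaries.
Proof.
have valP (a : R) (y z : cocycle C n) :
    val (a *: y + z) = a *: val y + val z by exact: linearP.
have val0 : val (0 : cocycle C n) = 0 by exact: linear0.
split=> [|a y z]; rewrite !inE ?valP ?val0.
  case: (n) => [//|m].
  by exists 0; rewrite /= ?rpred0 ?linear0.
case: (n) (val y) (val z) => [|m] u v /=.
  by move=> -> ->; rewrite scaler0 addr0.
move=> [phi Cphi <-] [psi Cpsi <-].
by exists (a *: phi + psi); [rewrite rpredD ?rpredZ | exact: cobd_is_linear].
Qed.

Definition cohomology : Type := quotient_module coboundaries_submod_closed.
HB.instance Definition _ := GRing.Lmodule.on cohomology.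

Definition cohomology_class : cocycle C n -> cohomology :=
  @quot_class R _ _ coboundaries_submod_closed.
HB.instance Definition _ := GRing.Linear.on cohomology_class.

Lemma cohomology_class_eq y z :
  cohomology_class y = cohomology_class z <-> cobd_image C (val y - val z).
Proof.
rewrite -(linearB val) /=.
by split=> [/quot_class_eq /asboolP|yz]; last exact/quot_class_eq/asboolP.
Qed.

Lemma cohomology_class_surj (x : cohomology) : exists z, cohomology_class z = x.
Proof. by exists (quot_repr x); exact: quot_reprK. Qed.

End Cohomology.

Section InducedMap.
Variables (C D : subcochains) (CD : forall n, {subset C n <= D n}) (n : nat).

Lemma cobd_image_sub : @cobd_image C n `<=` @cobd_image D n.
Proof. by case: n => [//|m] _ /= [phi Cphi <-]; exists phi => //; exact: CD. Qed.

Lemma cocycle_inclP (z : cocycle C n) : val z \in @cocycles D n.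
Proof. by have /andP[/CD Dz dz] := valP z; apply/andP. Qed.

Definition cocycle_incl (z : cocycle C n) : cocycle D n :=
  exist _ (val z) (cocycle_inclP z).

Definition induced_map (x : cohomology C n) : cohomology D n :=
  cohomology_class (cocycle_incl (quot_repr x)).

Lemma induced_mapE z :
  induced_map (cohomology_class z) = cohomology_class (cocycle_incl z).
Proof.
apply/cohomology_class_eq => /=.
have /cohomology_class_eq : cohomology_class (quot_repr (cohomology_class z)) =
  cohomology_class z by exact: quot_reprK.
exact: cobd_image_sub.
Qed.

Lemma induced_map_is_linear : linear induced_map.
Proof.
move=> a x y; have [u <-] := cohomology_class_surj x.
have [v <-] := cohomology_class_surj y.
rewrite -linearP !induced_mapE -linearP; congr cohomology_class.
by apply: val_inj; rewrite [RHS]linearP [LHS]linearP.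
Qed.

HB.instance Definition _ :=
  GRing.isLinear.Build R (cohomology C n) (cohomology D n) *:%R induced_map
    induced_map_is_linear.

End InducedMap.

Definition all_cochains n : {pred cochain n} := predT.

Lemma all_cochains_submod_closed n : submod_closed (@all_cochains n).
Proof. by []. Qed.

HB.instance Definition _ n :=
  GRing.isSubmodClosed.Build R (cochain n) (@all_cochains n)
    (@all_cochains_submod_closed n).

Definition full_complex : subcochains := fun n => @all_cochains n.

End Cohomology.

Section GrowthCohomology.
Context (R : realType) (G : groupType) (S : seq G) (T : growth R).
Local Notation ell := (word_length S).
Local Notation cochain := (@cochain R G).

Definition poly_growth n (k : R) (phi : cochain n) : Prop :=
  exists2 C : R, 0 < C & forall g,
    `|phi g| <= C * \prod_(i < n) (ell (tnth g i)).+1%:R `^ k.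

Definition exp_growth n (a : R) (phi : cochain n) : Prop :=
  exists2 C : R, 0 < C & forall g,
    `|phi g| <= C * a ^+ (\sum_(i < n) ell (tnth g i))%N.

Definition has_growth n (phi : cochain n) : Prop :=
  match T with
  | GrowthO => exists2 a : R, 1 < a & exp_growth a phi
  | GrowthS k => poly_growth k%:num phi
  | GrowthSinfty => exists k : nat, poly_growth k%:R phi
  | GrowthSomega => forall a : R, 1 < a -> exp_growth a phi
  end.

Definition growth_cochains n : {pred cochain n} :=
  [pred phi | `[< has_growth phi >]].

Let closed_bound n (w : n.-tuple G -> R) : (forall g, 0 <= w g) ->
  submod_closed [pred phi : cochain n |
    `[< exists2 C : R, 0 < C & forall g, `|phi g| <= C * w g >]].
Proof.
move=> w0; split=> [|a phi psi]; rewrite !inE.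
  by exists 1 => // g; rewrite normr0 mul1r.
move=> [C C0 hC] [D D0 hD]; exists (`|a| * C + D).
  by rewrite ltr_wpDl// mulr_ge0// ltW.
move=> g; rewrite mulrDl -mulrA (le_trans (ler_normD _ _))// lerD//.
by rewrite normrM ler_wpM2l.
Qed.

Let poly_weight_ge0 n k (g : n.-tuple G) :
  0 <= \prod_(i < n) (ell (tnth g i)).+1%:R `^ k :> R.
Proof. by apply: prodr_ge0 => i _; exact: powR_ge0. Qed.

Let poly_growthW n (k l : R) (phi : cochain n) :
  k <= l -> poly_growth k phi -> poly_growth l phi.
Proof.
move=> kl [C C0 hC]; exists C => // g; rewrite (le_trans (hC g))//.
apply: ler_wpM2l; first exact: ltW.
by apply: ler_prod => i _; rewrite powR_ge0 /= ler_powR// ler1n.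
Qed.

Let exp_growthW n (a b : R) (phi : cochain n) :
  1 < a -> a <= b -> exp_growth a phi -> exp_growth b phi.
Proof.
move=> a1 ab [C C0 hC]; exists C => // g; rewrite (le_trans (hC g))//.
have a0 : 0 <= a by rewrite ltW// (lt_trans ltr01).
apply: ler_wpM2l; first exact: ltW.
by rewrite lerXn2r// nnegrE// (le_trans a0).
Qed.

Lemma growth_cochains_submod_closed n : submod_closed (@growth_cochains n).
Proof.
have polyP k := closed_bound (@poly_weight_ge0 n k).
have expP (a : R) : 1 < a -> submod_closed [pred phi : cochain n |
    `[< exp_growth a phi >]].
  by move=> a1; apply: closed_bound => g; rewrite exprn_ge0// ltW// (lt_trans ltr01).
rewrite /growth_cochains /has_growth; case: T => [|k||].
- split=> [|b phi psi]; rewrite !inE.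
    exists 2; first by rewrite ltr1n.
    by have [+ _] := expP 2 (ltr1n _ _); rewrite inE.
  move=> [a a1 aphi] [c c1 cpsi]; exists (Num.max a c); first by rewrite lt_max a1.
  have m1 : 1 < Num.max a c by rewrite lt_max a1.
  have [_ /(_ b phi psi)] := expP _ m1; rewrite !inE; apply.
    by apply: exp_growthW aphi; rewrite // le_max lexx.
  by apply: exp_growthW cpsi; rewrite // le_max lexx orbT.
- exact: polyP.
- split=> [|b phi psi]; rewrite !inE.
    by exists 0%N; have [+ _] := polyP 0; rewrite inE.
  move=> [k kphi] [l lpsi]; exists (maxn k l).
  have [_ /(_ b phi psi)] := polyP (maxn k l)%:R; rewrite !inE; apply.
    by apply: poly_growthW kphi; rewrite ler_nat leq_maxl.
  by apply: poly_growthW lpsi; rewrite ler_nat leq_maxr.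
- split=> [|b phi psi]; rewrite !inE.
    by move=> a a1; have [+ _] := expP a a1; rewrite inE.
  move=> aphi apsi a a1; have [_ /(_ b phi psi)] := expP a a1.
  by rewrite !inE; apply; [exact: aphi | exact: apsi].
Qed.

HB.instance Definition _ n :=
  GRing.isSubmodClosed.Build R (cochain n) (@growth_cochains n)
    (@growth_cochains_submod_closed n).

Definition growth_complex : subcochains R G := fun n => @growth_cochains n.

Lemma growth_complex_sub n :
  {subset growth_complex n <= full_complex R G n}.
Proof. by []. Qed.

Definition canonical_map n :
    cohomology growth_complex n -> cohomology (full_complex R G) n :=
  @induced_map R G _ _ growth_complex_sub n.
HB.instance Definition _ n := GRing.Linear.on (@canonical_map n).

End GrowthCohomology.

Arguments canonical_map {R G} S T n _.

(* Main.v *)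
Require Import Defs.
From mathcomp Require Import all_boot all_order all_algebra.
From mathcomp Require Import all_classical all_reals all_analysis.
From mathcomp Require Import ring lra zify.

Set Implicit Arguments.
Unset Strict Implicit.
Unset Printing Implicit Defensive.

Import Order.TTheory GRing.Theory Num.Theory.
Local Open Scope classical_set_scope.
Local Open Scope ring_scope.

(** In homogeneous coordinates a cochain of degree [n] is a left invariant function
of [n.+1] group elements, its coboundary is the alternating sum of its values
on the faces of a tuple, and the growth conditions bound it by the product of
the weights of the steps from one entry to the next ([path_weight]).

A contracting homotopy of the tempered complex yields, by the recursion of the
method of acyclic models, an equivariant chain map from the bar resolution to
tempered chains: [comparison] sends a tuple to the homotopy, translated so as
to be based at the first entry, of the alternating sum of the values of
[comparison] on the faces.  Boundedness of the homotopy propagates through this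
recursion ([comparison_tame]): in each degree the values of [comparison] are
supported in one neighbourhood of the diagonal, and their norms are bounded by
path weights.  An invariant function, whatever its growth, is bounded on each
neighbourhood of the diagonal.  So integrating it against [comparison] gives a
cochain [pull] that satisfies the growth condition ([pull_growth]).

For surjectivity, every cocycle is cohomologous to its pull-back
([cocycle_growth_representative]): sending a tuple to its characteristic
function is a second equivariant chain map into tempered chains, and the same
recursion connects it to [comparison] by a homotopy, which may grow arbitrarily
fast.  For injectivity, let a cocycle [f] of controlled growth be the
coboundary of some [e].  Its pull-back is the coboundary of the pull-back of
[e], which has controlled growth, but one needs that [f] and its pull-back
differ by the coboundary of a cochain of controlled growth
([coboundary_growth_primitive]).  The previous homotopy cannot be estimated
because characteristic functions of long tuples are far from the diagonal.
Instead, [comparison] is regarded as a map from the bar resolution to its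
completion, and the prism operator
  x |-> sum_i (-1)^i (x_0, ..., x_i, comparison(x_i, ..., x_n))
is a homotopy from the identity to it.  Cochains of controlled growth can be
integrated against this, and the result has controlled growth ([prism_alt_sum],
[prism_growth]).

Two things complicate this picture.  Tempered chains vanish on tuples with two
equal consecutive entries, so cocycles must first be made to vanish there as
well; [normalize] does this, by the same recursion as for [comparison], applied
to functionals on functions with the cone construction as contraction.  And
the function spaces are of two kinds: a function belongs to the space if its
norms are finite for all weights, or for some weight, whereas the growth
condition on cochains carries the opposite quantifier.  The predicate [tame]
expresses continuity in both cases; that the homotopy is continuous is
automatic in the second case and follows from a rescaling argument in the first
([homotopy_tame_projective]). *)

(** * Alternating sums over faces *)

Section Faces.
Variable G : groupType.
Implicit Type V : zmodType.

Lemma face0 n b (y : n.+1.-tuple G) : face ord0 [tuple of b :: y] = y.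
Proof. by apply: eq_from_tnth => i; rewrite tnth_mktuple tnthS. Qed.

Lemma faceS n (j : 'I_n.+2) b (y : n.+2.-tuple G) :
  face (lift ord0 j) [tuple of b :: y] = [tuple of b :: face j y].
Proof.
apply: eq_from_tnth => i; rewrite tnth_mktuple.
case: (unliftP ord0 i) => [k ->|->].
  rewrite tnthS tnth_mktuple -(tnthS b y); congr tnth.
  by apply: val_inj; rewrite /= /bump !leq0n !add1n ltnS addnS.
by rewrite tnth0 (_ : lift _ _ = ord0) ?tnth0//; exact: val_inj.
Qed.

Lemma face1 b c : face (lift ord0 ord0) [tuple b; c] = [tuple b] :> 1.-tuple G.
Proof. by apply: eq_from_tnth => i; rewrite tnth_mktuple (ord1 i) !(tnth_nth b). Qed.

Definition alt_sum V n (A : n.+1.-tuple G -> V) (x : n.+2.-tuple G) : V :=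
  \sum_(j < n.+2) if odd j then - A (face j x) else A (face j x).

Lemma alt_sum_edge V (A : 1.-tuple G -> V) b c :
  alt_sum A [tuple b; c] = A [tuple c] - A [tuple b].
Proof.
rewrite /alt_sum big_ord_recl big_ord1 /= face1; congr (A _ - _).
exact: (face0 b [tuple c]).
Qed.

(** Prepending an entry is a contraction of the alternating sum; nearly all
    identities about [alt_sum] below come from this one by induction. *)
Lemma alt_sum_cons V n (A : n.+2.-tuple G -> V) b (y : n.+2.-tuple G) :
  alt_sum A [tuple of b :: y] =
  A y - alt_sum (fun z => A [tuple of b :: z]) y.
Proof.
rewrite /alt_sum big_ord_recl face0 /= -sumrN; congr (_ + _).
by apply: eq_bigr => j _; rewrite faceS /=; case: odd; rewrite ?opprK.
Qed.

Lemma eq_alt_sum V n (A B : n.+1.-tuple G -> V) :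
  A =1 B -> alt_sum A =1 alt_sum B.
Proof. by move=> AB x; apply: eq_bigr => j _; rewrite AB. Qed.

Lemma alt_sumD V n (A B : n.+1.-tuple G -> V) x :
  alt_sum (fun y => A y + B y) x = alt_sum A x + alt_sum B x.
Proof.
by rewrite -big_split; apply: eq_bigr => j _; case: odd; rewrite ?opprD.
Qed.

Lemma alt_sumN V n (A : n.+1.-tuple G -> V) x :
  alt_sum (fun y => - A y) x = - alt_sum A x.
Proof. by rewrite -sumrN; apply: eq_bigr => j _; case: odd. Qed.

Lemma alt_sumB V n (A B : n.+1.-tuple G -> V) x :
  alt_sum (fun y => A y - B y) x = alt_sum A x - alt_sum B x.
Proof. by rewrite alt_sumD alt_sumN. Qed.

Lemma alt_sum0 V n (x : n.+2.-tuple G) : alt_sum (fun=> 0) x = 0 :> V.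
Proof. by rewrite /alt_sum big1// => i _; rewrite oppr0 if_same. Qed.

Lemma alt_sum_fct (X : Type) V n (A : n.+1.-tuple G -> X -> V) x y :
  alt_sum A x y = alt_sum (fun z => A z y) x.
Proof.
rewrite /alt_sum fct_sumE; apply: eq_bigr => j _.
by case: odd; rewrite ?fctE.
Qed.

Lemma tuple1_cons n (x : n.+1.-tuple G) :
  exists b (y : n.-tuple G), x = [tuple of b :: y].
Proof. by case/tupleP: x => b y; exists b, y. Qed.

Lemma alt_sum_alt_sum V n (A : n.+1.-tuple G -> V) x :
  alt_sum (alt_sum A) x = 0.
Proof.
elim: n A x => [|n IH] A x; have [b [y ->]] := tuple1_cons x.
  rewrite alt_sum_cons; have [c [z ->]] := tuple1_cons y.
  have [d [z' ->]] := tuple1_cons z; rewrite (tuple0 z').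
  rewrite !alt_sum_edge/=.
  have edges (u v w : V) : u - v - (u - w - (v - w)) = 0.
    by rewrite !opprB addrA !subrKA subrr.
  exact: edges.
rewrite alt_sum_cons.
rewrite [X in _ - X](eq_alt_sum (B := fun z =>
  A z - alt_sum (fun t => A [tuple of b :: t]) z)).
  by rewrite alt_sumB IH subr0 subrr.
by move=> z; rewrite alt_sum_cons.
Qed.

Lemma degenerate_cons n b c (y : n.-tuple G) :
  degenerate [tuple of b :: [tuple of c :: y]] =
  (b == c) || degenerate [tuple of c :: y].
Proof. by rewrite /degenerate /= negb_and negbK. Qed.

Lemma degenerate_behead n b (y : n.+1.-tuple G) :
  degenerate y -> degenerate [tuple of b :: y].
Proof.
by have [c [z ->]] := tuple1_cons y; rewrite degenerate_cons => ->; rewrite orbT.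
Qed.

(** The two faces that omit one of two equal neighbours coincide and cancel, and
    every other face is degenerate. *)
Lemma alt_sum_degenerate V n (A : n.+1.-tuple G -> V) x :
  (forall y, degenerate y -> A y = 0) -> degenerate x -> alt_sum A x = 0.
Proof.
elim: n A x => [|n IH] A x A0; have [b [y ->]] := tuple1_cons x;
  have [c [z ->]] := tuple1_cons y; rewrite degenerate_cons.
  rewrite (tuple0 z) /degenerate /= orbF => /eqP ->.
  rewrite (_ : [tuple of _] = [tuple c; c]); last exact: val_inj.
  by rewrite alt_sum_edge subrr.
rewrite alt_sum_cons => /orP[/eqP bc|dz]; last first.
  rewrite IH ?A0 ?subrr// => t dt.
  by rewrite A0//; exact: degenerate_behead.
move: A0; rewrite {}bc => {b}; case: n IH A x y z => [|n] IH A x y z A0.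
  have [d [t ->]] := tuple1_cons z; rewrite (tuple0 t).
  rewrite (_ : [tuple of c :: [tuple of d :: _]] = [tuple c; d]); last exact: val_inj.
  rewrite alt_sum_edge [A [tuple of c :: [tuple c]]]A0 ?subr0; last first.
    by rewrite /degenerate /= eqxx.
  rewrite (_ : [tuple of c :: [tuple d]] = [tuple c; d]) ?subrr//; exact: val_inj.
rewrite alt_sum_cons [X in _ - (_ - X)](eq_alt_sum (B := fun=> 0)).
  by rewrite alt_sum0 subr0 subrr.
by move=> t; rewrite A0// degenerate_cons eqxx.
Qed.

Definition translate n (g : G) (x : n.-tuple G) : n.-tuple G :=
  [tuple of [seq (g * b)%g | b <- x]].

Lemma tnth_translate n g (x : n.-tuple G) i :
  tnth (translate g x) i = (g * tnth x i)%g.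
Proof. exact: tnth_map. Qed.

Lemma face_translate n j g (x : n.+2.-tuple G) :
  face j (translate g x) = translate g (face j x).
Proof.
by apply: eq_from_tnth => i; rewrite !(tnth_translate, tnth_mktuple).
Qed.

Lemma thead_translate n g (x : n.+1.-tuple G) :
  thead (translate g x) = (g * thead x)%g.
Proof. exact: tnth_translate. Qed.

End Faces.

Section AcyclicModels.
Variables (G : groupType) (D : nat -> zmodType).
(** The elements on which boundary and homotopy behave as they should; in degree
    zero these are reduced chains, so [basis x] is not among them. *)
Variable good : forall n, set (D n).
Hypothesis good0 : forall n, @good n.+1 0.
Hypothesis goodB : forall n c d, @good n.+1 c -> @good n.+1 d -> @good n.+1 (c - d).
Variable del : forall n, D n.+1 -> D n.
Hypothesis bdB : forall n c d, @good n.+1 c -> @good n.+1 d ->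
  del (c - d) = del c - del d.
Variable h : G -> forall n, D n -> D n.+1.
Variable basis : forall n, n.+1.-tuple G -> D n.
Arguments basis {n}.
Hypothesis basis_edge : forall b c, @good 0 (basis [tuple b] - basis [tuple c]).
Hypothesis good_basis : forall n (x : n.+2.-tuple G), good (basis x).
Hypothesis bd_basis : forall n (x : n.+2.-tuple G),
  del (basis x) = alt_sum basis x.
Hypothesis good_h : forall b n c, @good n c -> good (h b c).
Hypothesis h0 : forall b n, h b (0 : D n) = 0.
Hypothesis bd_h0 : forall b c, @good 0 c -> del (h b c) = c.
Hypothesis bd_h : forall b n c, @good n.+1 c -> del (h b c) + h b (del c) = c.

Let goodN n c : @good n.+1 c -> good (- c).
Proof. by move=> gc; rewrite -sub0r; exact: goodB. Qed.

Let goodD n c d : @good n.+1 c -> @good n.+1 d -> good (c + d).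
Proof. by move=> gc gd; rewrite -[d]opprK; apply: goodB => //; exact: goodN. Qed.

Let bd0 n : del (0 : D n.+1) = 0.
Proof. by rewrite -(subrr (0 : D n.+1)) bdB// subrr. Qed.

Lemma good_alt_sum n m (A : n.+1.-tuple G -> D m.+1) x :
  (forall y, good (A y)) -> good (alt_sum A x).
Proof.
move=> gA; apply: (big_ind (@good m.+1)) => //; first exact: goodD.
by move=> j _; case: odd; [exact: goodN|].
Qed.

Lemma bd_alt_sum n m (A : n.+1.-tuple G -> D m.+1) x :
  (forall y, good (A y)) -> del (alt_sum A x) = alt_sum (fun y => del (A y)) x.
Proof.
move=> gA; have bdN c : @good m.+1 c -> del (- c) = - del c.
  by move=> gc; rewrite -sub0r bdB// bd0 sub0r.
suff [] : del (alt_sum A x) = alt_sum (fun y => del (A y)) x /\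
  good (alt_sum A x) by [].
apply: (big_ind2 (fun c d => del c = d /\ good c)).
- by split; [exact: bd0|].
- move=> c d c' d' [<- gc] [<- gc']; split; last exact: goodD.
  by rewrite -[c']opprK bdB ?bdN//; exact: goodN.
- by move=> j _; case: odd; split; [exact: bdN|exact: goodN| |].
Qed.

(** The recursion of acyclic models: a tuple is filled by contracting, towards its
    first entry, the chain already assigned to its boundary. *)
Fixpoint model n : n.+1.-tuple G -> D n :=
  if n isn't m.+1 then basis
  else fun x => h (thead x) (alt_sum (@model m) x).

Lemma model_edge b c : @good 0 (alt_sum (@model 0) [tuple b; c]).
Proof. by rewrite alt_sum_edge; exact: basis_edge. Qed.

Lemma tuple2_edge (x : 2.-tuple G) : exists b c, x = [tuple b; c].
Proof.
have [b [y ->]] := tuple1_cons x; have [c [z ->]] := tuple1_cons y.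
by exists b, c; rewrite (tuple0 z); exact: val_inj.
Qed.

Lemma good_model n x : good (@model n.+1 x).
Proof.
elim: n x => [|n IH] x; last by apply/good_h/good_alt_sum.
by apply: good_h; have [b [c ->]] := tuple2_edge x; exact: model_edge.
Qed.

(** The contracted chain is a cycle by induction, so the homotopy identity turns
    the contraction into a filling of it. *)
Lemma bd_model n x : del (@model n.+1 x) = alt_sum (@model n) x.
Proof.
elim: n x => [|n IH] x.
  by apply: bd_h0; have [b [c ->]] := tuple2_edge x; exact: model_edge.
have g := good_alt_sum x (@good_model n).
rewrite -[RHS](bd_h (thead x) g) -[X in X = _]addr0; congr (_ + _).
rewrite bd_alt_sum; last exact: good_model.
by rewrite (eq_alt_sum (IH : (fun y => del (@model n.+1 y)) =1 _)) alt_sum_alt_sum h0.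
Qed.

(** The same recursion produces the homotopy between [model] and the chain map
    [basis]. *)
Fixpoint model_homotopy n : n.+1.-tuple G -> D n.+1 :=
  if n isn't m.+1 then fun=> 0
  else fun x => h (thead x)
         (@model m.+1 x - basis x - alt_sum (@model_homotopy m) x).

Let good_homotopy_arg n x :
  (forall y, good (@model_homotopy n y)) ->
  good (@model n.+1 x - basis x - alt_sum (@model_homotopy n) x).
Proof.
move=> gH; apply: goodB; last exact: good_alt_sum.
by apply: goodB; [exact: good_model|exact: good_basis].
Qed.

Lemma good_model_homotopy n x : good (@model_homotopy n x).
Proof.
by elim: n x => [|n IH] x //; apply: good_h; exact: good_homotopy_arg.
Qed.

Lemma bd_model_homotopy n x :
  del (@model_homotopy n.+1 x) =
  @model n.+1 x - basis x - alt_sum (@model_homotopy n) x.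
Proof.
have bd_arg m (y : m.+2.-tuple G) :
    (forall z, del (@model_homotopy m z) = @model m z - basis z
      - (if m is k.+1 return m.+1.-tuple G -> D m
         then alt_sum (@model_homotopy k) else fun=> 0) z) ->
    del (@model m.+1 y - basis y - alt_sum (@model_homotopy m) y) = 0.
  move=> IH; have gH := @good_model_homotopy m.
  rewrite bdB; [|apply: goodB; [exact: good_model|exact: good_basis]
    |exact: good_alt_sum].
  rewrite bdB; [|exact: good_model|exact: good_basis].
  rewrite bd_model bd_basis bd_alt_sum// (eq_alt_sum IH) !alt_sumB.
  case: m y {IH gH} => [|m] y; first by rewrite alt_sum0 subr0 subrr.
  by rewrite alt_sum_alt_sum subr0 subrr.
have step m (y : m.+2.-tuple G) :
    del (@model m.+1 y - basis y - alt_sum (@model_homotopy m) y) = 0 ->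
    del (@model_homotopy m.+1 y) =
      @model m.+1 y - basis y - alt_sum (@model_homotopy m) y.
  move=> arg0; have := bd_h (thead y) (good_homotopy_arg y (@good_model_homotopy m)).
  by rewrite arg0 h0 addr0.
elim: n x => [|n IH] x; apply/step/bd_arg => z; last exact: IH.
by rewrite /= bd0 !subrr.
Qed.

Variable act : G -> forall n, D n -> D n.
Hypothesis actB : forall g n, {morph @act g n : c d / c - d}.
Hypothesis act_h : forall g b n (c : D n), h (g * b)%g (act g c) = act g (h b c).
Hypothesis act_basis : forall g n (x : n.+1.-tuple G),
  basis (translate g x) = act g (basis x).

Lemma alt_sum_translate g n m (A : n.+1.-tuple G -> D m) x :
  (forall y, A (translate g y) = act g (A y)) ->
  alt_sum A (translate g x) = act g (alt_sum A x).
Proof.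
have act0 : act g (0 : D m) = 0 by rewrite -(subrr (0 : D m)) actB !subrr.
have actN (c : D m) : act g (- c) = - act g c by rewrite -sub0r actB act0 sub0r.
have actD (c d : D m) : act g (c + d) = act g c + act g d.
  by rewrite -{1}[d]opprK actB actN opprK.
move=> eqA; rewrite /alt_sum (big_morph _ actD act0); apply: eq_bigr => j _.
by rewrite face_translate eqA; case: odd; rewrite ?actN.
Qed.

Lemma model_translate g n x : @model n (translate g x) = act g (model x).
Proof.
elim: n x => [|n IH] x; first exact: act_basis.
by rewrite /= thead_translate alt_sum_translate// act_h.
Qed.

Lemma model_homotopy_translate g n x :
  @model_homotopy n (translate g x) = act g (model_homotopy x).
Proof.
elim: n x => [|n IH] x.
  by rewrite /= -(subrr (0 : D 1)) actB !subrr.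
rewrite -[LHS]/(h (thead (translate g x)) (@model n.+1 (translate g x)
  - basis (translate g x) - alt_sum (@model_homotopy n) (translate g x))).
by rewrite thead_translate alt_sum_translate// model_translate act_basis -!actB act_h.
Qed.

End AcyclicModels.
(** * Word length *)

Section WordLengthTheory.
Variables (G : groupType) (S : seq G).
Hypothesis genS : generates S.
Local Notation ell := (word_length S).

Lemma word_length_spells g : exists2 w, spells S w g & size w = ell g.
Proof.
rewrite /word_length; case: pselect => [e|[]]; last first.
  by have [w wg] := genS g; exists (size w); apply/asboolP; exists w.
by case: ex_minnP => m /asboolP.
Qed.

Lemma word_length_le w g : spells S w g -> (ell g <= size w)%N.
Proof.
move=> wg; have gw : has_word S g (size w) by apply/asboolP; exists w.
rewrite /word_length; case: pselect => [e|//].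
by case: ex_minnP => m _; exact.
Qed.

Lemma word_length1 : ell 1%g = 0%N.
Proof.
by apply/eqP; rewrite -leqn0 (@word_length_le [::])// /spells /= big_nil.
Qed.

Lemma word_lengthM g h : (ell (g * h)%g <= ell g + ell h)%N.
Proof.
have [v /andP[Sv /eqP vg] <-] := word_length_spells g.
have [w /andP[Sw /eqP wh] <-] := word_length_spells h.
rewrite -size_cat word_length_le// /spells all_cat Sv Sw /=.
by rewrite big_cat /= vg wh.
Qed.

Lemma finite_ball r : finite_set [set g | (ell g <= r)%N].
Proof.
pose A := S ++ map (fun s => s^-1)%g S.
suff fin m : finite_set [set g | exists2 w : seq G, spells S w g & size w = m].
  apply: (@sub_finite_set _ _ (\bigcup_(m in `I_r.+1)
      [set g | exists2 w : seq G, spells S w g & size w = m])).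
    move=> g /= gr; exists (ell g); first exact: gr.
    exact: word_length_spells.
  by apply: bigcup_finite => // m _; exact: fin.
elim: m => [|m IH].
  apply: (@sub_finite_set _ _ [set 1%g]); last exact: finite_set1.
  by move=> g [[|//] /andP[_ /eqP <-] _]; rewrite big_nil.
apply: (@sub_finite_set _ _ (image2 [set` A]
    [set g | exists2 w : seq G, spells S w g & size w = m]
    (fun a b => a * b)%g)).
  move=> g [[//|s w] /andP[/= /andP[Ss Sw] /eqP <-] [sw]].
  exists s.
    rewrite /= mem_cat; case/orP: Ss => [->//|Ss].
    by apply/orP; right; apply/mapP; exists (s^-1)%g => //; rewrite invgK.
  exists (\prod_(s <- w) s)%g; first by exists w => //; rewrite /spells Sw eqxx.
  by rewrite big_cons.
exact: finite_image2.
Qed.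

End WordLengthTheory.

(** * Weights *)

Section Weights.
Variables (R : realType) (T : growth R).

Definition weight_index : set R :=
  match T with
  | GrowthS k => [set k%:num]
  | GrowthSinfty => range (fun k : nat => k%:R)
  | _ => [set a | 1 < a]
  end.

Definition length_weight (a : R) (m : nat) : R :=
  match T with
  | GrowthS _ | GrowthSinfty => m.+1%:R `^ a
  | _ => a ^+ m
  end.

(** Among the four kinds of spaces, S^omega is the only one that is a union over its
    weights; the others are intersections. *)
Definition inductive_growth : bool := if T is GrowthSomega then true else false.

(** The quantifier over weights in the definition of the function spaces and their
    bounded subsets; [dual_quantifier] is the one in the growth conditions on
    cochains. *)
Definition space_quantifier (P : set R) : Prop :=
  if inductive_growth then exists2 a, weight_index a & P a
  else forall a, weight_index a -> P a.

Definition dual_quantifier (P : set R) : Prop :=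
  if inductive_growth then forall a, weight_index a -> P a
  else exists2 a, weight_index a & P a.

(** Norm estimates relating a weight [a] at the source to a weight [b] at the target:
    continuity between intersections of normed spaces, and boundedness between
    unions of normed spaces. *)
Definition tame (P : R -> set R) : Prop :=
  if inductive_growth
  then forall a, weight_index a -> exists2 b, weight_index b & P a b
  else forall b, weight_index b -> exists2 a, weight_index a & P a b.

Definition mono_rel (P : R -> set R) : Prop :=
  forall a a' b b', weight_index a -> weight_index a' ->
    weight_index b -> weight_index b' ->
    a <= a' -> b' <= b -> P a b -> P a' b'.

Lemma weight_index_max a b :
  weight_index a -> weight_index b -> weight_index (Num.max a b).
Proof. by move=> Ia Ib; rewrite maxEle; case: ifP. Qed.

Lemma weight_index_min a b :
  weight_index a -> weight_index b -> weight_index (Num.min a b).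
Proof. by move=> Ia Ib; rewrite minEle; case: ifP. Qed.

Lemma weight_index_nonempty : exists a, weight_index a.
Proof.
rewrite /weight_index; case: T => [|k||]; try by exists 2; rewrite /= ltr1n.
  by exists k%:num.
by exists 0, 0%N.
Qed.

Lemma tame_comp (P Q Q' : R -> set R) :
  (forall a b c, weight_index a -> weight_index b -> weight_index c ->
    P a c -> Q c b -> Q' a b) ->
  tame P -> tame Q -> tame Q'.
Proof.
rewrite /tame; case: inductive_growth => PQ tP tQ.
  move=> a Ia; have [c Ic Pac] := tP a Ia; have [b Ib Qcb] := tQ c Ic.
  by exists b => //; exact: PQ Pac Qcb.
move=> b Ib; have [c Ic Qcb] := tQ b Ib; have [a Ia Pac] := tP c Ic.
by exists a => //; exact: PQ Pac Qcb.
Qed.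

Lemma tameW (P Q : R -> set R) :
  (forall a b, weight_index a -> weight_index b -> P a b -> Q a b) ->
  tame P -> tame Q.
Proof.
rewrite /tame; case: inductive_growth => PQ tP.
  by move=> a Ia; have [b Ib Pab] := tP a Ia; exists b => //; exact: PQ.
by move=> b Ib; have [a Ia Pab] := tP b Ib; exists a => //; exact: PQ.
Qed.

Lemma tame_and (P Q : R -> set R) : mono_rel P -> mono_rel Q ->
  tame P -> tame Q -> tame (fun a b => P a b /\ Q a b).
Proof.
move=> mP mQ; rewrite /tame; case: inductive_growth => tP tQ.
  move=> a Ia; have [b Ib Pab] := tP a Ia; have [c Ic Qac] := tQ a Ia.
  have Im := weight_index_min Ib Ic; exists (Num.min b c) => //; split.
    by apply: mP Pab; rewrite // ge_min lexx.
  by apply: mQ Qac; rewrite // ge_min lexx orbT.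
move=> b Ib; have [a Ia Pab] := tP b Ib; have [c Ic Qcb] := tQ b Ib.
have Im := weight_index_max Ia Ic; exists (Num.max a c) => //; split.
  by apply: mP Pab; rewrite // le_max lexx.
by apply: mQ Qcb; rewrite // le_max lexx orbT.
Qed.

Lemma tame_ge : tame (fun a b => b <= a).
Proof. by rewrite /tame; case: inductive_growth => a Ia; exists a => /=. Qed.

Lemma tame_and_ge (P : R -> set R) : mono_rel P ->
  tame P -> tame (fun a b => b <= a /\ P a b).
Proof.
move=> mP; apply: tame_and => //; last exact: tame_ge.
by move=> a a' b b' _ _ _ _ aa' b'b ba; exact: le_trans (le_trans b'b ba) aa'.
Qed.

Lemma tame_inhabited (P : R -> set R) : tame P ->
  exists a b, [/\ weight_index a, weight_index b & P a b].
Proof.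
have [c Ic] := weight_index_nonempty; rewrite /tame.
case: inductive_growth => /(_ c Ic)[d Id Pcd]; first by exists c, d.
by exists d, c.
Qed.

Lemma dual_quantifier_tame (P : R -> set R) (Q Q' : set R) :
  (forall a b, weight_index a -> weight_index b -> P a b -> Q b -> Q' a) ->
  tame P -> dual_quantifier Q -> dual_quantifier Q'.
Proof.
rewrite /tame /dual_quantifier; case: inductive_growth => PQ tP.
  move=> eQ a Ia; have [b Ib Pab] := tP a Ia.
  by apply: PQ Pab _ => //; exact: eQ.
move=> [b Ib Qb]; have [a Ia Pab] := tP b Ib.
by exists a => //; exact: PQ Qb.
Qed.

Lemma tame_dual_quantifier (P : R -> set R) (Q : set R) :
  (forall a b, weight_index a -> weight_index b -> P a b -> Q a) ->
  tame P -> dual_quantifier Q.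
Proof.
move=> PQ tP; apply: (dual_quantifier_tame (Q := setT) _ tP).
  by move=> a b Ia Ib Pab _; exact: PQ Pab.
have [c Ic] := weight_index_nonempty.
by rewrite /dual_quantifier; case: inductive_growth => //; exists c.
Qed.

Lemma space_quantifier_and (P Q P' : set R) :
  (forall a b, weight_index a -> weight_index b -> a <= b -> P b -> P a) ->
  (forall a b, weight_index a -> weight_index b -> a <= b -> Q b -> Q a) ->
  (forall a, weight_index a -> P a -> Q a -> P' a) ->
  space_quantifier P -> space_quantifier Q -> space_quantifier P'.
Proof.
rewrite /space_quantifier; case: inductive_growth => mP mQ PQ.
  move=> [a Ia Pa] [b Ib Qb]; have Im := weight_index_min Ia Ib.
  exists (Num.min a b) => //; apply: PQ => //.
    by apply: mP Pa; rewrite // ge_min lexx.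
  by apply: mQ Qb; rewrite // ge_min lexx orbT.
by move=> eP eQ a Ia; apply: PQ => //; [exact: eP|exact: eQ].
Qed.

Lemma space_quantifierW (P Q : set R) :
  (forall a, weight_index a -> P a -> Q a) -> space_quantifier P -> space_quantifier Q.
Proof.
rewrite /space_quantifier; case: inductive_growth => PQ; last first.
  by move=> eP a Ia; apply: PQ => //; exact: eP.
by move=> [a Ia Pa]; exists a => //; exact: PQ.
Qed.

Lemma dual_quantifierW (P Q : set R) :
  (forall a, weight_index a -> P a -> Q a) -> dual_quantifier P -> dual_quantifier Q.
Proof.
rewrite /dual_quantifier; case: inductive_growth => PQ.
  by move=> eP a Ia; apply: PQ => //; exact: eP.
by move=> [a Ia Pa]; exists a => //; exact: PQ.
Qed.

Lemma dual_quantifier_and (P Q P' : set R) :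
  (forall a b, weight_index a -> weight_index b -> a <= b -> P a -> P b) ->
  (forall a b, weight_index a -> weight_index b -> a <= b -> Q a -> Q b) ->
  (forall a, weight_index a -> P a -> Q a -> P' a) ->
  dual_quantifier P -> dual_quantifier Q -> dual_quantifier P'.
Proof.
rewrite /dual_quantifier; case: inductive_growth => mP mQ PQ.
  by move=> eP eQ a Ia; apply: PQ => //; [exact: eP|exact: eQ].
move=> [a Ia Pa] [b Ib Qb]; have Im := weight_index_max Ia Ib.
exists (Num.max a b) => //; apply: PQ => //.
  by apply: mP Pa; rewrite // le_max lexx.
by apply: mQ Qb; rewrite // le_max lexx orbT.
Qed.

Lemma quantifiers_meet (P Q : set R) : space_quantifier P -> dual_quantifier Q ->
  exists a, [/\ weight_index a, P a & Q a].
Proof.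
rewrite /space_quantifier /dual_quantifier; case: inductive_growth.
  by move=> [a Ia Pa] eQ; exists a; split=> //; exact: eQ.
by move=> eP [a Ia Qa]; exists a; split=> //; exact: eP.
Qed.

(** An intersection over all weights is an intersection over a sequence of them,
    which is what makes sequential arguments possible. *)
Lemma cofinal_weights : ~~ inductive_growth -> exists2 u : nat -> R,
  forall k, weight_index (u k)
  & forall a, weight_index a -> exists K, forall k, (K <= k)%N -> a <= u k.
Proof.
rewrite /inductive_growth /weight_index; case: T => [|k||] // _.
- exists (fun k => k.+2%:R) => [k /=|a a1]; first by rewrite ltr1n.
  exists (Num.truncn a) => k ak; have a0 : 0 <= a by rewrite ltW// (lt_trans ltr01).
  rewrite (le_trans (ltW (truncnS_gt a)))// ler_nat.
  exact: (leq_trans (n := k.+1)).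
- by exists (fun=> k%:num) => [//|a ->]; exists 0%N.
- exists (fun k => k%:R) => [k|_ [m _ <-]]; first by exists k.
  by exists m => k mk; rewrite ler_nat.
Qed.

Lemma weight_index_ge0 a : weight_index a -> 0 <= a.
Proof.
rewrite /weight_index; case: T => [|k||] /=.
- by move=> a1; rewrite ltW// (lt_trans ltr01).
- by move=> ->.
- by move=> [k _ <-].
- by move=> a1; rewrite ltW// (lt_trans ltr01).
Qed.

Lemma length_weight0 a : length_weight a 0 = 1.
Proof. by rewrite /length_weight; case: T => *; rewrite ?expr0 ?powR1. Qed.

Lemma length_weight_homo a m n : weight_index a -> (m <= n)%N ->
  length_weight a m <= length_weight a n.
Proof.
move=> Ia mn; have a0 := weight_index_ge0 Ia.
have powle : m.+1%:R `^ a <= n.+1%:R `^ a :> R.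
  by rewrite ge0_ler_powR// ?nnegrE ?ler_nat.
move: Ia; rewrite /length_weight /weight_index; case: T => [|k||] //= a1.
  by rewrite ler_weXn2l// ltW.
by rewrite ler_weXn2l// ltW.
Qed.

Lemma length_weight_ge1 a m : weight_index a -> 1 <= length_weight a m.
Proof. by move=> Ia; rewrite -(length_weight0 a) length_weight_homo. Qed.

Lemma length_weightD a m n : weight_index a ->
  length_weight a (m + n) <= length_weight a m * length_weight a n.
Proof.
move=> Ia; have a0 := weight_index_ge0 Ia.
have powle : (m + n).+1%:R `^ a <= m.+1%:R `^ a * n.+1%:R `^ a :> R.
  rewrite -powRM// ge0_ler_powR// ?nnegrE// -natrM ler_nat.
  by rewrite mulSn mulnS; lia.
by rewrite /length_weight; case: T => [|k||] //; rewrite exprD.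
Qed.

Lemma length_weight_mono a b m : weight_index a -> weight_index b -> a <= b ->
  length_weight a m <= length_weight b m.
Proof.
move=> Ia Ib ab; have a0 := weight_index_ge0 Ia; have b0 := weight_index_ge0 Ib.
rewrite /length_weight; case: T => [|k||].
- by rewrite lerXn2r.
- by rewrite ler_powR// ler1n.
- by rewrite ler_powR// ler1n.
- by rewrite lerXn2r.
Qed.

End Weights.
(** * Absolutely summable families *)

Section Sums.
Variable R : realType.
Implicit Types I X Y : choiceType.

Lemma esumZ I (t : R) (f : I -> R) : 0 <= t -> (forall i, 0 <= f i) ->
  (\esum_(i in [set: I]) (t * f i)%:E = t%:E * \esum_(i in [set: I]) (f i)%:E)%E.
Proof.
move=> t0 f0; have le (s : R) (g : I -> R) : 0 <= s -> (forall i, 0 <= g i) ->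
    (\esum_(i in [set: I]) (s * g i)%:E <=
     s%:E * \esum_(i in [set: I]) (g i)%:E)%E.
  move=> s0 g0; apply: ge_ereal_sup => _ /= [A [finA _] <-].
  under eq_fsbigr do rewrite EFinM.
  rewrite -ge0_mule_fsumr; last by move=> i; rewrite lee_fin.
  apply: lee_pmul => //; first by rewrite fsume_ge0// => i _; rewrite lee_fin.
  by apply: esum_ge; exists A.
apply/eqP; rewrite eq_le le//=; have [->|tn0] := eqVneq t 0.
  by rewrite mul0e esum_ge0// => i _; rewrite mul0r.
have t_gt0 : 0 < t by rewrite lt_neqAle eq_sym tn0.
rewrite -lee_pdivlMl//; apply: le_trans (le _ (fun i => t * f i) _ _).
- by under [leRHS]eq_esum do rewrite mulKf//.
- by rewrite invr_ge0.
- by move=> i; rewrite mulr_ge0.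
Qed.

Lemma esum_finite_support I (A : set I) (f : I -> R) : (forall i, 0 <= f i) ->
  finite_set (A `&` [set i | f i != 0]) ->
  \esum_(i in A) (f i)%:E = (\sum_(i \in A) f i)%:E.
Proof.
move=> f0 fin; pose F := A `&` [set i | f i != 0].
have -> : \sum_(i \in A) f i = \sum_(i \in F) f i.
  apply/esym/fsbig_widen => [i []//|i [Ai nF] /=].
  by apply/eqP; apply: contrapT => /negP fi; apply: nF.
rewrite -fsumEFin// -esum_fset//; last by move=> i _; rewrite lee_fin.
rewrite [RHS]esum_mkcondr; apply: eq_esum => i Ai.
by case: ifPn => //; rewrite notin_setE /= => /negP; rewrite negbK => /eqP ->.
Qed.

Lemma fsum_restrict I (A F : set I) (f : I -> R) :
  (forall i, A i -> f i != 0 -> F i) ->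
  \sum_(i \in A) f i = \sum_(i \in A `&` F) f i.
Proof.
move=> AF; apply/esym/fsbig_widen => [i []//|i [Ai nAF]] /=.
by apply/eqP; apply: contrapT => /negP fi; apply: nAF; split => //; exact: AF.
Qed.

Lemma fsumB_restrict I (A F : set I) (f g : I -> R) : finite_set F ->
  (forall i, A i -> f i != 0 -> F i) -> (forall i, A i -> g i != 0 -> F i) ->
  \sum_(i \in A) (f i - g i) = \sum_(i \in A) f i - \sum_(i \in A) g i.
Proof.
move=> finF fF gF; rewrite (fsum_restrict fF) (fsum_restrict gF).
rewrite (@fsum_restrict _ A F (fun i => f i - g i)); last first.
  move=> i Ai; have [fi0|fi _] := eqVneq (f i) 0; last exact: fF.
  by rewrite fi0 sub0r oppr_eq0; exact: gF.
have fin : finite_set (A `&` F) by exact: finite_setIr.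
by rewrite fsbig_split//= !fsbig_finite// sumrN.
Qed.

Definition abs_summable I (f : I -> R) : Prop :=
  (\esum_(i in [set: I]) (`|f i|)%:E < +oo)%E.

Definition pos_part I (f : I -> R) i : R := Num.max (f i) 0.
Definition neg_part I (f : I -> R) i : R := Num.max (- f i) 0.

Lemma pos_part_ge0 I (f : I -> R) i : 0 <= pos_part f i.
Proof. by rewrite le_max lexx orbT. Qed.

Lemma neg_part_ge0 I (f : I -> R) i : 0 <= neg_part f i.
Proof. by rewrite le_max lexx orbT. Qed.

Lemma pos_part_le I (f : I -> R) i : pos_part f i <= `|f i|.
Proof. by rewrite ge_max ler_norm normr_ge0. Qed.

Lemma neg_part_le I (f : I -> R) i : neg_part f i <= `|f i|.
Proof. by rewrite ge_max normr_ge0 andbT -normrN ler_norm. Qed.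

Lemma pos_neg_part I (f : I -> R) i : f i = pos_part f i - neg_part f i.
Proof.
rewrite /pos_part /neg_part; have [f0|f0] := leP (f i) 0.
  by rewrite max_l ?oppr_ge0// sub0r opprK.
by rewrite max_r ?oppr_le0 ?ltW// subr0.
Qed.

Lemma esum_lty_le I (f g : I -> R) : (forall i, f i <= g i) ->
  (\esum_(i in [set: I]) (g i)%:E < +oo ->
   \esum_(i in [set: I]) (f i)%:E < +oo)%E.
Proof. by move=> fg; apply: le_lt_trans; apply: le_esum => i _; rewrite lee_fin. Qed.

Lemma esum_fin_num I (f : I -> R) : (forall i, 0 <= f i) ->
  (\esum_(i in [set: I]) (f i)%:E < +oo)%E ->
  \esum_(i in [set: I]) (f i)%:E \is a fin_num.
Proof.
move=> f0 flt; rewrite ge0_fin_numE//; apply: esum_ge0 => i _.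
by rewrite lee_fin.
Qed.

Lemma esumD_real I (f g : I -> R) : (forall i, 0 <= f i) -> (forall i, 0 <= g i) ->
  (\esum_(i in [set: I]) (f i + g i)%:E =
   \esum_(i in [set: I]) (f i)%:E + \esum_(i in [set: I]) (g i)%:E)%E.
Proof. by move=> f0 g0; rewrite -esumD// => i _; rewrite lee_fin. Qed.

(** This makes [real_sum] linear: the positive part of a sum is not the sum of
    the positive parts, but any decomposition into nonnegative families will do. *)
Lemma real_sum_diff I (p q : I -> R) :
  (forall i, 0 <= p i) -> (forall i, 0 <= q i) ->
  (\esum_(i in [set: I]) (p i)%:E < +oo)%E ->
  (\esum_(i in [set: I]) (q i)%:E < +oo)%E ->
  real_sum (fun i => p i - q i) =
  fine (\esum_(i in [set: I]) (p i)%:E) - fine (\esum_(i in [set: I]) (q i)%:E).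
Proof.
move=> p0 q0 pfin qfin; have summ (f : I -> R) : (forall i, 0 <= f i) ->
    (\esum_(i in [set: I]) (f i)%:E < +oo)%E -> summable setT (EFin \o f).
  move=> f0 ffin; rewrite /summable; apply: le_lt_trans ffin.
  by apply: le_esum => i _ /=; rewrite ger0_norm.
have := esumB (summ p p0 pfin) (summ q q0 qfin)
  (fun i _ => p0 i : (0 <= (p i)%:E)%E) (fun i _ => q0 i : (0 <= (q i)%:E)%E).
have -> : (fun x => ((EFin \o p) x - (EFin \o q) x)%E) =
    EFin \o (fun i => (p i - q i)%R) by apply/funext => i /=.
have fpos :
    \esum_(i in [set: I]) ((EFin \o (fun i => (p i - q i)%R))^\+ i)%E \is a fin_num.
  rewrite ge0_fin_numE; last by apply: esum_ge0 => i _; exact: funepos_ge0.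
  apply: le_lt_trans pfin; apply: le_esum => i _ /=.
  by rewrite funeposE ge_max !lee_fin p0 gerBl q0.
have fneg :
    \esum_(i in [set: I]) ((EFin \o (fun i => (p i - q i)%R))^\- i)%E \is a fin_num.
  rewrite ge0_fin_numE; last by apply: esum_ge0 => i _; exact: funeneg_ge0.
  apply: le_lt_trans qfin; apply: le_esum => i _ /=.
  by rewrite funenegE ge_max -EFinN !lee_fin q0 opprB gerBl p0.
rewrite /real_sum -fineB// => ->.
by rewrite fineB//; exact: esum_fin_num.
Qed.

Lemma abs_summable_pos I (f : I -> R) : abs_summable f ->
  (\esum_(i in [set: I]) (pos_part f i)%:E < +oo)%E.
Proof. by apply: esum_lty_le => i; exact: pos_part_le. Qed.

Lemma abs_summable_neg I (f : I -> R) : abs_summable f ->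
  (\esum_(i in [set: I]) (neg_part f i)%:E < +oo)%E.
Proof. by apply: esum_lty_le => i; exact: neg_part_le. Qed.

Lemma real_sumE I (f : I -> R) : abs_summable f ->
  real_sum f = fine (\esum_(i in [set: I]) (pos_part f i)%:E)
             - fine (\esum_(i in [set: I]) (neg_part f i)%:E).
Proof.
move=> sf; rewrite -real_sum_diff.
- by congr real_sum; apply/funext => i; exact: pos_neg_part.
- exact: pos_part_ge0.
- exact: neg_part_ge0.
- exact: abs_summable_pos.
- exact: abs_summable_neg.
Qed.

Lemma abs_summableB I (f g : I -> R) : abs_summable f -> abs_summable g ->
  abs_summable (fun i => f i - g i).
Proof.
rewrite /abs_summable => sf sg.
apply: (@esum_lty_le _ _ (fun i => `|f i| + `|g i|)).
  by move=> i; exact: ler_normB.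
by rewrite esumD_real//; exact: lte_add_pinfty.
Qed.

Lemma real_sumB I (f g : I -> R) : abs_summable f -> abs_summable g ->
  real_sum (fun i => f i - g i) = real_sum f - real_sum g.
Proof.
move=> sf sg; have := (abs_summable_pos sf, abs_summable_neg sf,
  abs_summable_pos sg, abs_summable_neg sg) => -[[[fp fn] gp] gn].
have -> : (fun i => f i - g i) = (fun i => (pos_part f i + neg_part g i)
    - (neg_part f i + pos_part g i)).
  by apply/funext => i; rewrite {1}[f i]pos_neg_part {1}[g i]pos_neg_part; ring.
have ge0 := (@pos_part_ge0, @neg_part_ge0).
rewrite real_sum_diff; try by move=> i; rewrite addr_ge0 ?ge0.
- rewrite !esumD_real ?ge0//; try by move=> i; rewrite ge0.
  rewrite !fineD ?esum_fin_num ?ge0//; try by move=> i; rewrite ge0.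
  by rewrite !real_sumE//; ring.
- by rewrite esumD_real; [exact: lte_add_pinfty| |] => i; rewrite ge0.
- by rewrite esumD_real; [exact: lte_add_pinfty| |] => i; rewrite ge0.
Qed.

Lemma abs_summable0 I : abs_summable (fun _ : I => 0).
Proof. by rewrite /abs_summable esum1 ?ltry// => i _; rewrite normr0. Qed.

Lemma real_sum0 I : real_sum (fun _ : I => 0 : R) = 0.
Proof.
have s0 := abs_summable0 I; have := real_sumB s0 s0.
by under [X in real_sum X]eq_fun do rewrite subr0; rewrite subrr.
Qed.

Lemma abs_summableN I (f : I -> R) : abs_summable f ->
  abs_summable (fun i => - f i).
Proof. by move=> sf; rewrite /abs_summable; under eq_esum do rewrite normrN. Qed.

Lemma real_sumN I (f : I -> R) : abs_summable f ->
  real_sum (fun i => - f i) = - real_sum f.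
Proof.
move=> sf; rewrite -sub0r -(real_sum0 I) -real_sumB//; last exact: abs_summable0.
by congr real_sum; apply/funext => i; rewrite sub0r.
Qed.

Lemma abs_summableD I (f g : I -> R) : abs_summable f -> abs_summable g ->
  abs_summable (fun i => f i + g i).
Proof.
move=> sf sg; under eq_fun do rewrite -[X in _ + X]opprK.
by apply: abs_summableB => //; exact: abs_summableN.
Qed.

Lemma real_sumD I (f g : I -> R) : abs_summable f -> abs_summable g ->
  real_sum (fun i => f i + g i) = real_sum f + real_sum g.
Proof.
move=> sf sg; under eq_fun do rewrite -[X in _ + X]opprK.
by rewrite real_sumB ?real_sumN ?opprK//; exact: abs_summableN.
Qed.

Lemma real_sumZ I (t : R) (f : I -> R) : 0 <= t -> abs_summable f ->
  real_sum (fun i => t * f i) = t * real_sum f.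
Proof.
move=> t0 sf; rewrite (real_sumE sf) mulrBr.
have -> : (fun i => t * f i) = (fun i => t * pos_part f i - t * neg_part f i).
  by apply/funext => i; rewrite {1}[f i]pos_neg_part mulrBr.
have pf := abs_summable_pos sf; have nf := abs_summable_neg sf.
have scale (g : I -> R) : (forall i, 0 <= g i) ->
    (\esum_(i in [set: I]) (g i)%:E < +oo)%E ->
    (\esum_(i in [set: I]) (t * g i)%:E < +oo)%E /\
    fine (\esum_(i in [set: I]) (t * g i)%:E) =
    t * fine (\esum_(i in [set: I]) (g i)%:E).
  move=> g0 gfin; have /fineK gK := esum_fin_num g0 gfin.
  by rewrite esumZ// -gK -EFinM ltry.
have [pt pE] := scale _ (pos_part_ge0 f) pf.
have [nt nE] := scale _ (neg_part_ge0 f) nf.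
rewrite real_sum_diff ?pE ?nE//.
- by move=> i; rewrite mulr_ge0// pos_part_ge0.
- by move=> i; rewrite mulr_ge0// neg_part_ge0.
Qed.

Lemma ler_real_sum I (f g : I -> R) (C : R) : (forall i, `|f i| <= g i) ->
  (\esum_(i in [set: I]) (g i)%:E <= C%:E)%E -> `|real_sum f| <= C.
Proof.
move=> fg gC; have g0 i : 0 <= g i by exact: le_trans (fg i).
have sf : abs_summable f by apply: esum_lty_le fg _; exact: le_lt_trans gC (ltry _).
have part (p : I -> R) : (forall i, 0 <= p i) -> (forall i, p i <= `|f i|) ->
    0 <= fine (\esum_(i in [set: I]) (p i)%:E) <= C.
  move=> p0 pf; have pC : (\esum_(i in [set: I]) (p i)%:E <= C%:E)%E.
    apply: le_trans gC; apply: le_esum => i _.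
    by rewrite lee_fin (le_trans (pf i)).
  have pfin : \esum_(i in [set: I]) (p i)%:E \is a fin_num.
    by apply: esum_fin_num => //; exact: le_lt_trans pC (ltry _).
  rewrite -!lee_fin fineK// pC andbT esum_ge0// => i _.
  by rewrite lee_fin.
have /andP[P0 PC] := part _ (pos_part_ge0 f) (pos_part_le f).
have /andP[N0 NC] := part _ (neg_part_ge0 f) (neg_part_le f).
by rewrite real_sumE// ler_norml; lra.
Qed.

Lemma esum_fibers X Y (p : X -> Y) (u : X -> R) : (forall x, 0 <= u x) ->
  (forall y, finite_set [set x | p x = y /\ u x != 0]) ->
  \esum_(x in [set: X]) (u x)%:E =
  \esum_(y in [set: Y]) (\sum_(x \in [set x | p x = y]) u x)%:E.
Proof.
move=> u0 fin.
transitivity (\esum_(y in [set: Y]) \esum_(x in [set x | p x = y]) (u x)%:E).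
  rewrite esum_esum; last by move=> *; rewrite lee_fin.
  apply: (reindex_esum ([set: Y] `*`` (fun y => [set x | p x = y])) setT
    (fun k : Y * X => k.2) (fun x => (u x)%:E)).
  split=> //.
    by move=> [y x] [y' x'] /[!inE] -[/= _ <-] [_ <-] ->.
  by move=> x _; exists (p x, x).
apply: eq_esum => y _; apply: esum_finite_support => //.
by apply: sub_finite_set (fin y) => x [].
Qed.

(** The nonnegative case, applied to positive and negative parts.  The inner sums
    are finite, as in the definition of [bd]. *)
Lemma real_sum_fibers X Y (p : X -> Y) (t : X -> R) : abs_summable t ->
  (forall y, finite_set [set x | p x = y /\ t x != 0]) ->
  abs_summable (fun y => \sum_(x \in [set x | p x = y]) t x) /\
  real_sum t = real_sum (fun y => \sum_(x \in [set x | p x = y]) t x).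
Proof.
move=> st fin; have suppE (u : X -> R) x :
    0 <= u x -> u x <= `|t x| -> u x != 0 -> t x != 0.
  move=> u0 ut; apply: contraNN => /eqP tx0.
  by rewrite eq_le u0 andbT (le_trans ut)// tx0 normr0.
have posS x := suppE _ x (pos_part_ge0 t x) (pos_part_le t x).
have negS x := suppE _ x (neg_part_ge0 t x) (neg_part_le t x).
have pfin y : finite_set [set x | p x = y /\ pos_part t x != 0].
  by apply: sub_finite_set (fin y) => x [pxy /posS].
have nfin y : finite_set [set x | p x = y /\ neg_part t x != 0].
  by apply: sub_finite_set (fin y) => x [pxy /negS].
have sp := abs_summable_pos st; have sn := abs_summable_neg st.
have pE := esum_fibers (pos_part_ge0 t) pfin.
have nE := esum_fibers (neg_part_ge0 t) nfin.
have fibE : (fun y => \sum_(x \in [set x | p x = y]) t x) =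
    (fun y => \sum_(x \in [set x | p x = y]) pos_part t x
            - \sum_(x \in [set x | p x = y]) neg_part t x).
  apply/funext => y; rewrite -(fsumB_restrict (fin y)).
  - by apply: eq_fsbigr => x _; rewrite -pos_neg_part.
  - by move=> x /= pxy /posS.
  - by move=> x /= pxy /negS.
have fp0 y : 0 <= \sum_(x \in [set x | p x = y]) pos_part t x.
  by apply: fsumr_ge0 => x _; exact: pos_part_ge0.
have fn0 y : 0 <= \sum_(x \in [set x | p x = y]) neg_part t x.
  by apply: fsumr_ge0 => x _; exact: neg_part_ge0.
rewrite fibE; split; last by rewrite real_sumE// pE nE -real_sum_diff -?pE -?nE.
by apply: abs_summableB; rewrite /abs_summable;
  under eq_esum do rewrite ger0_norm//; rewrite -?pE -?nE.
Qed.

Lemma real_sum_support1 I (i0 : I) (f : I -> R) :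
  (forall i, i != i0 -> f i = 0) -> abs_summable f /\ real_sum f = f i0.
Proof.
move=> f0.
have e1 (g : I -> R) : (forall i, 0 <= g i) -> (forall i, i != i0 -> g i = 0) ->
    \esum_(i in [set: I]) (g i)%:E = (g i0)%:E.
  move=> g0 gi0; transitivity (\esum_(i in [set i0]) (g i)%:E).
    2: by rewrite esum_set1// lee_fin.
  rewrite [RHS]esum_mkcond; apply: eq_esum => i _ /=.
  by rewrite in_set1; case: eqVneq => [->//|/gi0 ->].
have sf : abs_summable f.
  rewrite /abs_summable (e1 (fun i => `|f i|)) ?ltry// => i /f0 ->.
  exact: normr0.
split=> //; rewrite real_sumE// !e1 /=.
- by rewrite -pos_neg_part.
- exact: neg_part_ge0.
- by move=> i /f0 fi; rewrite /neg_part fi oppr0 maxxx.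
- exact: pos_part_ge0.
- by move=> i /f0 fi; rewrite /pos_part fi maxxx.
Qed.

End Sums.
(** * Weighted norms on chains *)

Section Paths.
Variables (R : realType) (G : groupType) (S : seq G).
Hypothesis genS : generates S.
Variable T : growth R.
Local Notation ell := (word_length S).
Local Notation index := (weight_index T).

Definition weight (a : R) (g : G) : R := length_weight T a (ell g).

Lemma weight1 a : weight a 1%g = 1.
Proof. by rewrite /weight word_length1// length_weight0. Qed.

Lemma weight_ge1 a g : index a -> 1 <= weight a g.
Proof. exact: length_weight_ge1. Qed.

Lemma weight_ge0 a g : index a -> 0 <= weight a g.
Proof. by move=> /weight_ge1 w1; exact: le_trans (w1 g). Qed.

Lemma weightM a g h : index a -> weight a (g * h)%g <= weight a g * weight a h.
Proof.
move=> Ia; rewrite (le_trans (length_weight_homo Ia (word_lengthM genS g h)))//.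
exact: length_weightD.
Qed.

Lemma weight_mono a b g : index a -> index b -> a <= b -> weight a g <= weight b g.
Proof. exact: length_weight_mono. Qed.

Lemma weight_triangle a p q r : index a ->
  weight a (p^-1 * r)%g <= weight a (p^-1 * q)%g * weight a (q^-1 * r)%g.
Proof.
move=> Ia; rewrite (_ : p^-1 * r = (p^-1 * q) * (q^-1 * r))%g ?weightM//.
by rewrite -mulgA mulVKg.
Qed.

Fixpoint path_weight (a : R) (p : G) (s : seq G) : R :=
  if s is b :: s' then weight a (p^-1 * b)%g * path_weight a b s' else 1.

Lemma path_weight_ge1 a p s : index a -> 1 <= path_weight a p s.
Proof.
move=> Ia; elim: s p => [|b s IH] p //=.
by rewrite -[1]mulr1 ler_pM// weight_ge1.
Qed.

Lemma path_weight_ge0 a p s : index a -> 0 <= path_weight a p s.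
Proof. by move=> Ia; exact: le_trans (path_weight_ge1 p s Ia). Qed.

Lemma path_weight_mono a b p s : index a -> index b -> a <= b ->
  path_weight a p s <= path_weight b p s.
Proof.
move=> Ia Ib ab; elim: s p => [|c s IH] p //=.
by rewrite ler_pM ?weight_ge0 ?path_weight_ge0// weight_mono.
Qed.

Lemma path_weight_base a p q s : index a ->
  path_weight a p s <= weight a (p^-1 * q)%g * path_weight a q s.
Proof.
move=> Ia; case: s => [|b s] /=; first by rewrite mulr1 weight_ge1.
by rewrite mulrA ler_wpM2r ?path_weight_ge0// weight_triangle.
Qed.

Lemma path_weight_thead a p n (x : n.+1.-tuple G) :
  path_weight a p x = weight a (p^-1 * thead x)%g * path_weight a (thead x) x.
Proof.
by have [b [y ->]] := tuple1_cons x; rewrite theadE /= mulVg weight1 mul1r.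
Qed.

Lemma path_weight_thead_le a p n (x : n.+1.-tuple G) : index a ->
  path_weight a (thead x) x <= path_weight a p x.
Proof.
move=> Ia; rewrite [leRHS]path_weight_thead ler_peMl ?path_weight_ge0//.
exact: weight_ge1.
Qed.

(** Omitting an entry shortens the path because weights are submultiplicative. *)
Lemma path_weight_face a p n j (x : n.+2.-tuple G) : index a ->
  path_weight a p (face j x) <= path_weight a p x.
Proof.
move=> Ia; elim: n p j x => [|n IH] p j x; have [b [y ->]] := tuple1_cons x;
  (case: (unliftP ord0 j) => [k ->|->]; last by
    rewrite face0; exact: path_weight_base).
  have [c [z ->]] := tuple1_cons y; rewrite (tuple0 z) ord1.
  rewrite -[face _ _]/(face (lift ord0 ord0) [tuple b; c]) face1 /=.
  by rewrite !mulr1 ler_peMr ?weight_ge0 ?weight_ge1.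
by rewrite faceS; apply: ler_wpM2l; [exact: weight_ge0|exact: IH].
Qed.

Lemma path_weight_face_thead a n j (x : n.+2.-tuple G) : index a ->
  weight a ((thead x)^-1 * thead (face j x))%g
    * path_weight a (thead (face j x)) (face j x) <= path_weight a (thead x) x.
Proof. by move=> Ia; rewrite -path_weight_thead path_weight_face. Qed.

Definition close (r : nat) n (x : n.-tuple G) : Prop :=
  forall i j, (word_dist S (tnth x i) (tnth x j) <= r)%N.

Lemma close_face r n j (x : n.+2.-tuple G) : close r x -> close r (face j x).
Proof. by move=> rx i k; rewrite !tnth_mktuple. Qed.

Lemma close_behead r n b (y : n.-tuple G) :
  close r [tuple of b :: y] -> close r y.
Proof.
by move=> rby i j; have := rby (lift ord0 i) (lift ord0 j); rewrite !tnthS.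
Qed.

Lemma close_translate r g n (x : n.-tuple G) : close r (translate g x) <-> close r x.
Proof.
have eqd i j : word_dist S (tnth (translate g x) i) (tnth (translate g x) j) =
    word_dist S (tnth x i) (tnth x j).
  by rewrite /word_dist !tnth_translate invgM mulgA mulgVK.
by split=> rx i j; have := rx i j; rewrite eqd.
Qed.

Lemma path_weight_close a r n (x : n.+1.-tuple G) : index a -> close r x ->
  path_weight a (thead x) x <= length_weight T a r ^+ n.
Proof.
move=> Ia; elim: n x => [|n IH] x rx; have [b [y eqx]] := tuple1_cons x.
  by rewrite eqx (tuple0 y) /= mulVg weight1 mulr1.
move: rx; rewrite eqx => rx; have [c [z eqy]] := tuple1_cons y.
rewrite theadE /= mulVg weight1 mul1r path_weight_thead exprS ler_pM//.
- exact: weight_ge0.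
- exact: path_weight_ge0.
- apply: length_weight_homo => //.
  have := rx ord0 (lift ord0 ord0); rewrite tnth0 tnthS eqy tnth0.
  by rewrite theadE.
- exact/IH/(close_behead rx).
Qed.

Lemma close_exists n (x : n.-tuple G) : exists r, close r x.
Proof.
exists (\sum_i \sum_j word_dist S (tnth x i) (tnth x j))%N => i j.
rewrite (bigD1 i)//= (leq_trans _ (leq_addr _ _))// (bigD1 j)//=.
exact: leq_addr.
Qed.

Lemma close_leq r r' n (x : n.-tuple G) : (r <= r')%N -> close r x -> close r' x.
Proof. by move=> rr' rx i j; exact: leq_trans (rx i j) rr'. Qed.

Lemma finite_tuples (B : set G) n :
  finite_set B -> finite_set [set y : n.-tuple G | forall i, B (tnth y i)].
Proof.
move=> finB; elim: n => [|n IH].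
  apply: (@sub_finite_set _ _ [set [tuple]]); last exact: finite_set1.
  by move=> y _; rewrite (tuple0 y).
apply: (@sub_finite_set _ _ (image2 B [set y : n.-tuple G | forall i, B (tnth y i)]
    (fun b (y : n.-tuple G) => [tuple of b :: y]))); last exact: finite_image2.
move=> x Bx; have [b [y eqx]] := tuple1_cons x; subst x.
exists b; first by have := Bx ord0; rewrite tnth0.
by exists y => // i; have := Bx (lift ord0 i); rewrite tnthS.
Qed.

Lemma finite_ball_at r g : finite_set [set b | (word_dist S g b <= r)%N].
Proof.
apply: (@sub_finite_set _ _ [set (g * c)%g | c in [set c | (ell c <= r)%N]]).
  by move=> b gb; exists (g^-1 * b)%g => //; rewrite mulVKg.
by apply: finite_image; exact: finite_ball.
Qed.

Lemma finite_close_at r g n :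
  finite_set [set x : n.-tuple G | close r x /\ exists k, tnth x k = g].
Proof.
apply: sub_finite_set (finite_tuples n (finite_ball_at r g)) => x [rx [k <-]] i.
exact: rx.
Qed.

Lemma finite_close_cons r g n :
  finite_set [set y : n.-tuple G | close r [tuple of g :: y]].
Proof.
apply: sub_finite_set (finite_tuples n (finite_ball_at r g)) => y ry i.
by have := ry ord0 (lift ord0 i); rewrite tnth0 tnthS.
Qed.

Local Notation chain n := (n.+1.-tuple G -> R).

(** The norm of the mass of a chain, but with lengths measured from the point [p]
    instead of the unit element.  Moving the base point along with the chain makes
    translation isometric ([chain_norm_shift]). *)
Definition chain_norm (a : R) (p : G) n (c : chain n) : \bar R :=
  \esum_(x in [set: n.+1.-tuple G]) (`|c x| * weight a (p^-1 * thead x)%g)%:E.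

Lemma chain_norm_ge0 a p n (c : chain n) : index a -> (0 <= chain_norm a p c)%E.
Proof.
by move=> Ia; apply: esum_ge0 => x _; rewrite lee_fin mulr_ge0// weight_ge0.
Qed.

Lemma chain_normB a p n (c d : chain n) : index a ->
  (chain_norm a p (c - d)%R <= chain_norm a p c + chain_norm a p d)%E.
Proof.
move=> Ia; rewrite /chain_norm -esumD_real; try
  by move=> x; rewrite mulr_ge0// weight_ge0.
apply: le_esum => x _; rewrite lee_fin -mulrDl ler_wpM2r ?weight_ge0//.
exact: ler_normB.
Qed.

Lemma chain_norm0 a p n : chain_norm a p (0 : chain n) = 0%E.
Proof. by rewrite /chain_norm esum1// => x _; rewrite normr0 mul0r. Qed.

Lemma chain_normN a p n (c : chain n) : chain_norm a p (- c)%R = chain_norm a p c.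
Proof. by apply: eq_esum => x _; rewrite normrN. Qed.

Lemma chain_normZ a p n t (c : chain n) : index a ->
  chain_norm a p (t *: c)%R = (`|t|%:E * chain_norm a p c)%E.
Proof.
move=> Ia; rewrite /chain_norm -esumZ//; last first.
  by move=> x; rewrite mulr_ge0// weight_ge0.
by apply: eq_esum => x _; rewrite normrM mulrA.
Qed.

Lemma chain_norm_mono a b p n (c : chain n) : index a -> index b -> a <= b ->
  (chain_norm a p c <= chain_norm b p c)%E.
Proof.
by move=> Ia Ib ab; apply: le_esum => x _; rewrite lee_fin ler_wpM2l// weight_mono.
Qed.

Lemma chain_norm_base a p q n (c : chain n) : index a ->
  (chain_norm a p c <= (weight a (p^-1 * q)%g)%:E * chain_norm a q c)%E.
Proof.
move=> Ia; rewrite /chain_norm -esumZ ?weight_ge0//; last first.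
  by move=> x; rewrite mulr_ge0// weight_ge0.
apply: le_esum => x _; rewrite lee_fin mulrCA ler_wpM2l//.
exact: weight_triangle.
Qed.

Definition shift (g : G) n (c : chain n) : chain n := fun x => c (translate g^-1 x).

Lemma translateK g n : cancel (@translate G n g) (translate g^-1).
Proof. by move=> x; apply: eq_from_tnth => i; rewrite !tnth_translate mulKg. Qed.

Lemma translateVK g n : cancel (@translate G n g^-1) (translate g).
Proof. by move=> x; apply: eq_from_tnth => i; rewrite !tnth_translate mulVKg. Qed.

Lemma translate_bij g n : bijective (@translate G n g).
Proof. by exists (translate g^-1); [exact: translateK|exact: translateVK]. Qed.

Lemma esum_translate g n (f : n.-tuple G -> \bar R) :
  \esum_(x in [set: n.-tuple G]) f x =
  \esum_(x in [set: n.-tuple G]) f (translate g x).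
Proof. by apply: reindex_esum; rewrite setTT_bijective; exact: translate_bij. Qed.

Lemma chain_norm_shift a g p n (c : chain n) :
  chain_norm a (g * p)%g (shift g c) = chain_norm a p c.
Proof.
rewrite /chain_norm (esum_translate g); apply: eq_esum => x _.
by rewrite /shift translateK thead_translate invgM mulgA mulgVK.
Qed.

Definition function_norm (a : R) (f : G -> R) : \bar R :=
  \esum_(x in [set: G]) (`|f x| * weight a x)%:E.

Definition near_diagonal (r : nat) n (c : chain n) : Prop :=
  (forall x, ~ close r x -> c x = 0) /\ (forall x, degenerate x -> c x = 0).

(** By Fubini, since the sums that define the mass are finite. *)
Lemma mass_norm a r n (c : chain n) : index a -> near_diagonal r c ->
  function_norm a (mass c) = chain_norm a 1%g c.
Proof.
move=> Ia [rc _]; rewrite /chain_norm.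
rewrite (reindex_esum [set: G * n.-tuple G] _ (fun k => [tuple of k.1 :: k.2]));
  last first.
  split=> //.
    move=> [g y] [h z] _ _ /(congr1 val) /= [-> yz]; congr pair.
    exact: val_inj.
  move=> x _; have [b [y eqx]] := tuple1_cons x.
  by exists (b, y).
have -> : [set: G * n.-tuple G] = [set: G] `*`` (fun=> [set: n.-tuple G]).
  by apply/seteqP; split.
rewrite -(@esum_esum _ _ _ _ _ (fun g (y : n.-tuple G) =>
  (`|c [tuple of g :: y]| * weight a (1^-1 * thead [tuple of g :: y])%g)%:E)).
  apply: eq_esum => g _; rewrite ger0_norm; last first.
    by apply: fsumr_ge0 => y _.
  rewrite /mass mulrC mulr_fsumr esum_finite_support.
  - by congr EFin; apply: eq_fsbigr => y _; rewrite theadE invg1 mul1g mulrC.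
  - by move=> y; rewrite mulr_ge0// weight_ge0.
  - apply: sub_finite_set (finite_close_cons r g n) => y [_ /=].
    apply: contraNP => /rc ->.
    by rewrite normr0 mul0r.
by move=> *; rewrite lee_fin mulr_ge0// weight_ge0.
Qed.

Lemma fun_spaceE f :
  fun_space S T f <-> space_quantifier T (fun a => (function_norm a f < +oo)%E).
Proof.
rewrite /fun_space /space_quantifier /function_norm /weight /length_weight
  /weight_index /poly_norm /exp_norm; case: T => [|k||] //=.
- by split=> [fk a -> //|fk]; exact: fk.
- by split=> [fk _ [k _ <-]//|fk k]; apply: fk; exists k.
Qed.

Lemma fun_boundedE F : fun_bounded S T F <->
  space_quantifier T (fun a => norm_bounded (function_norm a) F).
Proof.
rewrite /fun_bounded /space_quantifier /function_norm /weight /length_weight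
  /weight_index /poly_norm /exp_norm; case: T => [|k||] //=.
- by split=> [fk a -> //|fk]; exact: fk.
- by split=> [fk _ [k _ <-]//|fk k]; apply: fk; exists k.
Qed.

Lemma controlledE r n (c : chain n) : controlled_chains S T r c <->
  near_diagonal r c /\ space_quantifier T (fun a => (chain_norm a 1%g c < +oo)%E).
Proof.
have far x : ~ close r x <-> exists i j, (r < word_dist S (tnth x i) (tnth x j))%N.
  split=> [/existsNP[i /existsNP[j /negP]]|[i [j rij]] rx].
    by rewrite -ltnNge => rij; exists i, j.
  by have := rx i j; rewrite leqNgt rij.
split=> [[fc dc sc]|[[fc dc] sc]].
  have dr : near_diagonal r c by split=> // x /far; exact: fc.
  split=> //; move/fun_spaceE: sc; apply: space_quantifierW => a Ia.
  by rewrite (mass_norm Ia dr).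
split=> // [x /far|]; first exact: fc.
apply/fun_spaceE; move: sc; apply: space_quantifierW => a Ia.
by rewrite (mass_norm Ia (conj fc dc)).
Qed.

End Paths.
Arguments shift {R G} g {n} c _.
(** * Tempered chains *)

Section Tempered.
Variables (R : realType) (G : groupType) (S : seq G).
Hypothesis genS : generates S.
Variable T : growth R.
Local Notation index := (weight_index T).
Local Notation weight := (weight S T).
Local Notation chain_norm := (chain_norm S T).
Local Notation close := (close S).
Local Notation near_diagonal := (near_diagonal S).
Local Notation chain n := (n.+1.-tuple G -> R).
Local Notation chains := (chains S T).

Lemma near_diagonal_leq r r' n (c : chain n) : (r <= r')%N ->
  near_diagonal r c -> near_diagonal r' c.
Proof.
move=> rr' [rc dc]; split=> // x r'x; apply: rc => rx; apply: r'x.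
exact: close_leq rx.
Qed.

Lemma near_diagonalB r n (c d : chain n) :
  near_diagonal r c -> near_diagonal r d -> near_diagonal r (c - d).
Proof.
move=> [rc dc] [rd dd]; split=> x xP; rewrite !fctE.
  by rewrite rc ?rd ?subr0.
by rewrite dc ?dd ?subr0.
Qed.

Lemma near_diagonal0 r n : near_diagonal r (0 : chain n).
Proof. by []. Qed.

Lemma near_diagonalZ r n t (c : chain n) : near_diagonal r c ->
  near_diagonal r (t *: c).
Proof.
move=> [rc dc]; split=> x xP; rewrite -[LHS]/(t * c x).
  by rewrite rc ?mulr0.
by rewrite dc ?mulr0.
Qed.

Lemma degenerate_translate g n (x : n.-tuple G) :
  degenerate (translate g x) = degenerate x.
Proof.
rewrite /degenerate sorted_map; congr (~~ sorted _ _).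
by apply/funext => b; apply/funext => c; rewrite /= (inj_eq (mulgI g)).
Qed.

Lemma near_diagonal_shift r g n (c : chain n) : near_diagonal r c ->
  near_diagonal r (shift g c).
Proof.
move=> [rc dc]; split=> x xP; rewrite /shift.
  by apply: rc; rewrite close_translate.
by apply: dc; rewrite degenerate_translate.
Qed.

Lemma chainsE n (c : chain n) : chains c <->
  (exists r, near_diagonal r c) /\
  space_quantifier T (fun a => (chain_norm a 1%g c < +oo)%E).
Proof.
split=> [[r /(controlledE genS)[dr sc]]|[[r dr] sc]]; first by split=> //; exists r.
by exists r; apply/controlledE.
Qed.

Lemma chainsB n (c d : chain n) : chains c -> chains d -> chains (c - d).
Proof.
move=> /chainsE[[r rc] sc] /chainsE[[r' rd] sd]; apply/chainsE; split.
  exists (maxn r r'); apply: near_diagonalB.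
    by apply: near_diagonal_leq rc; exact: leq_maxl.
  by apply: near_diagonal_leq rd; exact: leq_maxr.
apply: space_quantifier_and sc sd => [a b Ia Ib ab|a b Ia Ib ab|a Ia ac ad].
- by move=> bc; apply: le_lt_trans bc; exact: chain_norm_mono.
- by move=> bc; apply: le_lt_trans bc; exact: chain_norm_mono.
- by apply: le_lt_trans (chain_normB _ _ _ _ Ia) _; exact: lte_add_pinfty.
Qed.

Lemma chainsZ n t (c : chain n) : chains c -> chains (t *: c).
Proof.
move=> /chainsE[[r rc] sc]; apply/chainsE; split.
  by exists r; exact: near_diagonalZ.
apply: space_quantifierW sc => a Ia ac; rewrite chain_normZ//.
rewrite -[X in (_ * X)%E]fineK; first by rewrite -EFinM ltry.
by rewrite ge0_fin_numE// chain_norm_ge0.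
Qed.

Lemma chains0 n : chains (0 : chain n).
Proof.
apply/chainsE; split; first by exists 0%N; exact: near_diagonal0.
have [a Ia] := weight_index_nonempty T.
rewrite /space_quantifier; case: inductive_growth; first exists a => //.
  by rewrite chain_norm0 ltry.
by move=> b _; rewrite chain_norm0 ltry.
Qed.

Lemma chainsN n (c : chain n) : chains c -> chains (- c).
Proof. by move=> cc; rewrite -sub0r; apply: chainsB => //; exact: chains0. Qed.

Lemma chains_alt_sum n m (A : n.+1.-tuple G -> chain m) x :
  (forall y, chains (A y)) -> chains (alt_sum A x).
Proof.
move=> cA; apply: (big_ind (@chains m)) => [|c d cc cd|j _].
- exact: chains0.
- by rewrite -[d]opprK; apply: chainsB => //; exact: chainsN.
- by case: odd => //; exact: chainsN.
Qed.

Lemma chain_norm_shift1 a g n (c : chain n) : index a ->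
  (chain_norm a 1%g (shift g c) <= (weight a g)%:E * chain_norm a 1%g c)%E.
Proof.
move=> Ia; apply: le_trans (chain_norm_base genS 1%g g (shift g c) Ia) _.
by rewrite invg1 mul1g -{2}[g]mulg1 chain_norm_shift.
Qed.

Lemma chains_shift g n (c : chain n) : chains c -> chains (shift g c).
Proof.
move=> /chainsE[[r rc] sc]; apply/chainsE; split.
  by exists r; exact: near_diagonal_shift.
apply: space_quantifierW sc => a Ia ac.
apply: le_lt_trans (chain_norm_shift1 g c Ia) _.
rewrite -[X in (_ * X)%E]fineK; first by rewrite -EFinM ltry.
by rewrite ge0_fin_numE// chain_norm_ge0.
Qed.

Lemma basis_chain_degenerate n (x : n.+1.-tuple G) :
  degenerate x -> basis_chain R x = 0.
Proof. by move=> dx; apply/funext => y; rewrite /basis_chain dx. Qed.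

Lemma chain_norm_basis a p n (x : n.+1.-tuple G) : index a ->
  (chain_norm a p (basis_chain R x) <= (weight a (p^-1 * thead x)%g)%:E)%E.
Proof.
move=> Ia; rewrite -[leRHS](@esum_set1 _ _ x
  (fun y : n.+1.-tuple G => (weight a (p^-1 * thead y)%g)%:E)); last first.
  by rewrite lee_fin weight_ge0.
rewrite [leRHS]esum_mkcond; apply: le_esum => y _; rewrite in_set1 /basis_chain.
have [->|yx] := eqVneq y x; last by rewrite andbF normr0 mul0r.
rewrite lee_fin andbT ler_piMl ?weight_ge0//.
by case: degenerate; rewrite ?normr0 ?normr1.
Qed.

Lemma near_diagonal_basis r n (x : n.+1.-tuple G) : close r x ->
  near_diagonal r (basis_chain R x).
Proof.
move=> rx; split=> y yP; rewrite /basis_chain; have [eqyx|] := eqVneq y x;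
  rewrite ?andbF//.
  by case: yP; rewrite eqyx.
by rewrite -eqyx yP.
Qed.

Lemma chains_basis n (x : n.+1.-tuple G) : chains (basis_chain R x).
Proof.
have [r rx] := close_exists S x; apply/chainsE; split.
  by exists r; exact: near_diagonal_basis.
have fin a : index a -> (chain_norm a 1%g (basis_chain R x) < +oo)%E.
  by move=> Ia; apply: le_lt_trans (chain_norm_basis _ _ Ia) (ltry _).
have [a Ia] := weight_index_nonempty T.
by rewrite /space_quantifier; case: inductive_growth => //; exists a => //; exact: fin.
Qed.

(** ** The boundary *)

Lemma bd_basis_face n (x : n.+2.-tuple G) y :
  bd_basis R x y != 0 -> exists j, face j x = y.
Proof.
rewrite /bd_basis; apply: contraNP => /forallNP xy; rewrite big1// => j _.
rewrite /basis_chain; have [yj|_] := eqVneq y (face j x).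
  by case: (xy j).
by rewrite andbF mulr0.
Qed.

Lemma finite_close_faces r n (y : n.+1.-tuple G) :
  finite_set [set x : n.+2.-tuple G | close r x /\ exists j, face j x = y].
Proof.
apply: sub_finite_set (finite_close_at genS r (thead y) n.+2) => x [rx [j <-]].
by split=> //; exists (lift j ord0); rewrite /thead tnth_mktuple.
Qed.

Lemma bd_support r n (c : chain n.+1) (y : n.+1.-tuple G) x :
  near_diagonal r c -> c x * bd_basis R x y != 0 ->
  close r x /\ exists j, face j x = y.
Proof.
move=> [rc _]; rewrite mulf_eq0 negb_or => /andP[cx xy]; split.
  by apply: contrapT => /rc cx0; rewrite cx0 eqxx in cx.
exact: bd_basis_face.
Qed.

Lemma bdB n (c d : chain n.+1) : chains c -> chains d -> bd (c - d) = bd c - bd d.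
Proof.
move=> /chainsE[[r rc] _] /chainsE[[r' rd] _]; apply/funext => y.
have rc' : near_diagonal (maxn r r') c.
  by apply: near_diagonal_leq rc; exact: leq_maxl.
have rd' : near_diagonal (maxn r r') d.
  by apply: near_diagonal_leq rd; exact: leq_maxr.
rewrite !fctE /bd -(fsumB_restrict (finite_close_faces (maxn r r') y)).
- by apply: eq_fsbigr => x _; rewrite -mulrBl.
- by move=> x _; exact: bd_support.
- by move=> x _; exact: bd_support.
Qed.

Lemma bd_basisE n (x : n.+2.-tuple G) :
  bd_basis R x = alt_sum (@basis_chain R G n) x.
Proof.
apply/funext => y; rewrite alt_sum_fct /bd_basis; apply: eq_bigr => j _.
by rewrite -signr_odd mulr_sign.
Qed.

Lemma bd_basis_chain n (x : n.+2.-tuple G) :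
  bd (basis_chain R x) = alt_sum (@basis_chain R G n) x.
Proof.
apply/funext => y; rewrite /bd.
have [dx|ndx] := boolP (degenerate x).
  rewrite basis_chain_degenerate// fsbig1; last by move=> z _; rewrite mul0r.
  by rewrite alt_sum_degenerate// => z; exact: basis_chain_degenerate.
rewrite -bd_basisE -(@fsbig_widen _ _ _ _ [set x]) ?fsbig_set1//.
  by rewrite /basis_chain ndx eqxx mul1r.
by move=> z [_ /= /eqP zx]; rewrite /basis_chain (negbTE zx) andbF mul0r.
Qed.

Lemma basis_chain_translate g n (x : n.+1.-tuple G) :
  basis_chain R (translate g x) = shift g (basis_chain R x).
Proof.
apply/funext => y; rewrite /shift /basis_chain degenerate_translate.
by rewrite -(can2_eq (@translateVK _ g _) (@translateK _ g _)).
Qed.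

Lemma bd_shift g n (c : chain n.+1) : bd (shift g c) = shift g (bd c).
Proof.
apply/funext => y; rewrite /shift /bd (reindex_fsbigT _ _ (translate_bij g n.+2)).
apply: eq_fsbigr => x _; rewrite /shift translateK; congr (_ * _).
rewrite !bd_basisE !alt_sum_fct; apply: eq_bigr => j _.
by rewrite face_translate basis_chain_translate.
Qed.

(** ** Pairing chains with functions *)

Definition pairing n (c f : chain n) : R := real_sum (fun x => c x * f x).

(** Functions that can be integrated against every tempered chain.  The constant
    may depend on the neighbourhood of the diagonal; this is why invariant functions
    of arbitrary growth qualify. *)
Definition pairable n (f : chain n) : Prop := forall r, dual_quantifier T (fun a =>
  exists2 D : R, 0 <= D & forall x, close r x -> `|f x| <= D * weight a (thead x)).

Lemma pairing_summable n (c f : chain n) : chains c -> pairable f ->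
  abs_summable (fun x => c x * f x).
Proof.
move=> /chainsE[[r [rc _]] sc] /(_ r) pf.
have [a [Ia ac [D D0 fD]]] := quantifiers_meet sc pf.
apply: (@esum_lty_le _ _ _ (fun x => D * (`|c x| * weight a (1^-1 * thead x)%g))).
  move=> x; rewrite invg1 mul1g normrM mulrCA.
  have [/rc ->|rx] := pselect (~ close r x); first by rewrite normr0 !mul0r.
  by apply: ler_wpM2l => //; apply: fD; exact: contrapT.
rewrite esumZ//; last by move=> x; rewrite mulr_ge0// weight_ge0.
rewrite -[X in (_ * X)%E]fineK; first by rewrite -EFinM ltry.
by rewrite ge0_fin_numE// chain_norm_ge0.
Qed.

Lemma pairingBl n (c d f : chain n) : chains c -> chains d -> pairable f ->
  pairing (c - d) f = pairing c f - pairing d f.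
Proof.
move=> cc cd pf; rewrite /pairing -real_sumB; try exact: pairing_summable.
by congr real_sum; apply/funext => x; rewrite -mulrBl.
Qed.

Lemma pairingBr n (c f g : chain n) : chains c -> pairable f -> pairable g ->
  pairing c (f - g) = pairing c f - pairing c g.
Proof.
move=> cc pf pg; rewrite /pairing -real_sumB; try exact: pairing_summable.
by congr real_sum; apply/funext => x; rewrite -mulrBr.
Qed.

Lemma pairing0l n (f : chain n) : pairing 0 f = 0.
Proof.
rewrite /pairing (_ : (fun x => _) = (fun=> 0)) ?real_sum0//.
by apply/funext => x; rewrite mul0r.
Qed.

Lemma pairing0r n (c : chain n) : pairing c 0 = 0.
Proof.
rewrite /pairing (_ : (fun x => _) = (fun=> 0)) ?real_sum0//.
by apply/funext => x; rewrite mulr0.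
Qed.

Lemma pairing_basis n (x : n.+1.-tuple G) (f : chain n) :
  (forall y, degenerate y -> f y = 0) -> pairing (basis_chain R x) f = f x.
Proof.
move=> f0; have [|_] := @real_sum_support1 R _ x (fun y => basis_chain R x y * f y).
  by move=> y /negbTE yx; rewrite /basis_chain yx andbF mul0r.
rewrite /pairing => ->; rewrite /basis_chain eqxx andbT.
by have [/f0 ->|_] := boolP (degenerate x); rewrite ?mulr0// mul1r.
Qed.

Lemma pairing_shift g n (c f : chain n) :
  pairing (shift g c) f = pairing c (fun x => f (translate g x)).
Proof.
rewrite /pairing /real_sum (esum_translate g) [X in _ - fine X](esum_translate g).
by congr (fine _ - fine _); apply: eq_esum => x _;
  rewrite /= ?funeposE ?funenegE /= /shift translateK.
Qed.

Lemma pairable_face n (f : chain n) (j : 'I_n.+2) : pairable f ->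
  pairable (fun x => f (face j x)).
Proof.
move=> pf r; apply: dual_quantifierW (pf r) => a Ia [D D0 fD].
have r0 : 0 <= length_weight T a r by exact: le_trans (length_weight_ge1 _ Ia).
exists (D * length_weight T a r) => [|x rx]; first exact: mulr_ge0.
apply: le_trans (fD _ (close_face j rx)) _.
rewrite -mulrA ler_wpM2l// mulrC.
rewrite -{1}(mulVKg (thead x) (thead (face j x))).
apply: le_trans (weightM genS _ _ Ia) _; rewrite ler_wpM2l ?weight_ge0//.
apply: length_weight_homo => //; rewrite /thead tnth_mktuple.
exact: rx.
Qed.

Lemma real_sum_sum (I : choiceType) (m : nat) (t : 'I_m -> I -> R) :
  (forall j, abs_summable (t j)) ->
  abs_summable (fun i => \sum_(j < m) t j i) /\
  real_sum (fun i => \sum_(j < m) t j i) = \sum_(j < m) real_sum (t j).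
Proof.
elim: m t => [|m IH] t st.
  have -> : (fun i => \sum_(j < 0) t j i) = (fun=> 0).
    by apply/funext => i; rewrite big_ord0.
  by rewrite big_ord0 real_sum0; split=> //; exact: abs_summable0.
have [s E] := IH (fun j => t (lift ord0 j)) (fun j => st _).
have -> : (fun i => \sum_(j < m.+1) t j i) =
    (fun i => t ord0 i + \sum_(j < m) t (lift ord0 j) i).
  by apply/funext => i; rewrite big_ord_recl.
by split; [exact: abs_summableD|rewrite real_sumD// E big_ord_recl].
Qed.

(** The boundary of a chain is the signed sum of its images under the faces, so
    it is adjoint to the alternating sum over faces; functions that do not
    vanish on degenerate tuples would see the terms that [bd] discards. *)
Lemma pairing_bd n (c : chain n.+1) (f : chain n) : chains c -> pairable f ->
  (forall y, degenerate y -> f y = 0) -> pairing (bd c) f = pairing c (alt_sum f).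
Proof.
move=> cc pf f0; have /chainsE[[r rc] _] := cc.
pose t (j : 'I_n.+2) x := c x * f (face j x).
have st j : abs_summable (t j) by exact/pairing_summable/pairable_face.
pose sg (j : 'I_n.+2) x := if odd j then - t j x else t j x.
have ssg j : abs_summable (sg j).
  by rewrite /sg; case: odd => //; exact: abs_summableN.
have -> : pairing c (alt_sum f) = real_sum (fun x => \sum_(j < n.+2) sg j x).
  congr real_sum; apply/funext => x; rewrite /alt_sum mulr_sumr.
  by apply: eq_bigr => j _; rewrite /sg /t; case: odd; rewrite ?mulrN.
have fin j y : finite_set [set x | face j x = y /\ sg j x != 0].
  apply: sub_finite_set (finite_close_faces r y) => x [jx sx]; split; last by exists j.
  apply: contrapT => /(proj1 rc) cx; move: sx.
  by rewrite /sg /t cx mul0r oppr0 if_same eqxx.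
rewrite (proj2 (real_sum_sum ssg)).
under eq_bigr => j _ do rewrite (proj2 (real_sum_fibers (ssg j) (fin j))).
have sfib j : abs_summable (fun y => \sum_(x \in [set x | face j x = y]) sg j x).
  exact: (proj1 (real_sum_fibers _ _)).
rewrite -(proj2 (real_sum_sum sfib)); congr real_sum; apply/funext => y.
pose F := [set x : n.+2.-tuple G | close r x /\ exists j, face j x = y].
have finF : finite_set F by exact: finite_close_faces.
rewrite /bd (@fsum_restrict _ _ _ F); last by move=> x _; exact: bd_support.
rewrite setTI mulr_fsuml.
transitivity (\sum_(x \in F) \sum_(j < n.+2) if face j x == y then sg j x else 0).
  apply: eq_fsbigr => x _; rewrite /bd_basis mulr_sumr mulr_suml.
  apply: eq_bigr => j _; rewrite /basis_chain [y == _]eq_sym.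
  have [jx|] := eqVneq (face j x) y; last by rewrite andbF !mulr0 mul0r.
  rewrite /sg /t andbT jx -signr_odd; case: odd; rewrite ?expr1 ?expr0;
    have [/f0 ->|_] := boolP (degenerate y); rewrite ?mulr0 ?mulr1 ?oppr0//.
  by rewrite mulrN mulr1 mulNr.
rewrite fsbig_finite// exchange_big /=; apply: eq_bigr => j _.
rewrite -fsbig_finite//.
rewrite [RHS](@fsum_restrict _ _ _ F); last first.
  move=> x /= jx sx; split; last by exists j.
  apply: contrapT => /(proj1 rc) cx; move: sx.
  by rewrite /sg /t cx mul0r oppr0 if_same eqxx.
rewrite [RHS]fsbig_mkcondl; apply: eq_fsbigr => x _.
have [jx|jx] := eqVneq (face j x) y; first by rewrite mem_set.
by rewrite memNset//= => /eqP; rewrite (negbTE jx).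
Qed.

End Tempered.
(** * Estimates for a contracting homotopy *)

Section Homotopy.
Variables (R : realType) (G : groupType) (S : seq G).
Hypothesis genS : generates S.
Variable T : growth R.
Local Notation index := (weight_index T).
Local Notation weight := (weight S T).
Local Notation path_weight := (path_weight S T).
Local Notation chain_norm := (chain_norm S T).
Local Notation close := (close S).
Local Notation near_diagonal := (near_diagonal S).
Local Notation chain n := (n.+1.-tuple G -> R).
Local Notation chains := (chains S T).
Local Notation reduced n := (@reduced_chains R G S T n).

Lemma reduced_chainsW n (c : chain n) : reduced n c -> chains c.
Proof. by case: n c => [|n] c // []. Qed.

Lemma chains_summable n (c : chain n) : chains c -> abs_summable c.
Proof.
move=> cc; rewrite (_ : c = fun x => c x * 1); last first.
  by apply/funext => x; rewrite mulr1.
apply: (@pairing_summable R G S genS T n c (fun=> 1)) => //.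
have [a Ia] := weight_index_nonempty T; move=> r.
have H b : index b -> exists2 D : R, 0 <= D & forall x : n.+1.-tuple G,
    close r x -> `|1| <= D * weight b (thead x).
  by move=> Ib; exists 1 => // x _; rewrite normr1 mul1r weight_ge1.
by rewrite /dual_quantifier; case: inductive_growth => //; exists a => //; exact: H.
Qed.

Lemma reducedZ n t (c : chain n) : 0 <= t -> reduced n c -> reduced n (t *: c).
Proof.
case: n c => [|n] c t0; last exact: chainsZ.
move=> [cc c0]; split; first exact: chainsZ.
rewrite /augmentation /= real_sumZ//; last exact: chains_summable.
by rewrite [real_sum c]c0 mulr0.
Qed.

Lemma reduced0 n : reduced n (0 : chain n).
Proof.
case: n => [|n]; last exact: chains0.
by split; [exact: chains0|exact: real_sum0].
Qed.

Lemma reduced_edge b c :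
  reduced 0 (basis_chain R [tuple b] - basis_chain R [tuple c]).
Proof.
split; first by apply: chainsB => //; exact: chains_basis.
have basis1 (x : 1.-tuple G) : abs_summable (basis_chain R x) /\
    real_sum (basis_chain R x) = 1.
  have [|s E] := @real_sum_support1 R _ x (basis_chain R x).
    by move=> y /negbTE yx; rewrite /basis_chain yx andbF.
  split=> //; rewrite {}E /basis_chain eqxx andbT.
  by have [b' [y ->]] := tuple1_cons x; rewrite (tuple0 y).
have [sb Eb] := basis1 [tuple b]; have [sc Ec] := basis1 [tuple c].
by rewrite /= /augmentation real_sumB// Eb Ec subrr.
Qed.

Lemma chains_boundedE n (F : set (chain n)) : @chains_bounded R G S T n F <->
  (exists r, forall c, F c -> near_diagonal r c) /\
  space_quantifier T (fun a => exists M : R,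
    forall c, F c -> (chain_norm a 1%g c <= M%:E)%E).
Proof.
split=> [[r Fr /fun_boundedE bF]|[[r Fr] bF]].
  have Fd c : F c -> near_diagonal r c by move=> /Fr /(controlledE genS) [].
  split; first by exists r.
  apply: space_quantifierW bF => a Ia [M FM]; exists M => c Fc.
  by rewrite -(mass_norm genS Ia (Fd c Fc)); apply: FM; exists c.
exists r => [c Fc|].
  apply/(controlledE genS); split; first exact: Fr.
  by apply: space_quantifierW bF => a Ia [M FM]; apply: le_lt_trans (FM c Fc) (ltry _).
apply/fun_boundedE; apply: space_quantifierW bF => a Ia [M FM].
by exists M => _ [c Fc <-]; rewrite (mass_norm genS Ia (Fr c Fc)) FM.
Qed.

Variable h : forall n, chain n -> chain n.+1.
Hypothesis contract : bounded_contracting_homotopy S T h.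

Lemma homotopy_linear n a c d : reduced n c -> reduced n d ->
  h (a *: c + d) = a *: h c + h d.
Proof. by have [/(_ n)[_ + _] _ _] := contract; exact. Qed.

Lemma homotopy0 n : h (0 : chain n) = 0.
Proof.
have := homotopy_linear 1 (reduced0 n) (reduced0 n); rewrite !scale1r addr0.
by move/eqP; rewrite -subr_eq subrr eq_sym => /eqP.
Qed.

Lemma homotopyZ n t (c : chain n) : reduced n c -> h (t *: c) = t *: h c.
Proof.
move=> rc; have := homotopy_linear t rc (reduced0 n).
by rewrite !addr0 homotopy0 addr0.
Qed.

Lemma homotopy_chains n (c : chain n) : reduced n c -> chains (h c).
Proof. by move=> rc; have [/(_ n)[+ _ _] _ _] := contract => /(_ c rc). Qed.

Lemma homotopy_bounded n (F : set (chain n)) : F `<=` reduced n ->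
  @chains_bounded R G S T n F -> @chains_bounded R G S T n.+1 (@h n @` F).
Proof.
move=> Fr Fb; have [/(_ n)[_ _ +] _ _] := contract => /(_ F).
by move=> /(_ (conj Fr Fb)) [].
Qed.

Lemma homotopy_rescale n t (c : chain n) : 0 < t -> reduced n c ->
  (forall r, near_diagonal r (h (t *: c)) -> near_diagonal r (h c)) /\
  (forall b (M : R), index b -> (chain_norm b 1%g (h (t *: c)) <= M%:E)%E ->
     (chain_norm b 1%g (h c) <= (t^-1 * M)%:E)%E).
Proof.
move=> t0 rc; have hcE : h c = t^-1 *: h (t *: c).
  by rewrite homotopyZ// scalerA mulVf ?scale1r// gt_eqF.
split=> [r rh|b M Ib bM]; rewrite hcE; first exact: near_diagonalZ.
rewrite chain_normZ// gtr0_norm ?invr_gt0// EFinM.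
by apply: lee_pmul => //; [rewrite lee_fin invr_ge0 ltW|exact: chain_norm_ge0].
Qed.

(** The summand 1 makes the estimate robust under the rescaling arguments below,
    where the norm of [c] may be zero; it is harmless because path weights are at
    least 1. *)
Definition homotopy_estimate n r (a b : R) : Prop :=
  exists r' (C : R), 0 <= C /\ forall c : chain n,
    reduced n c -> near_diagonal r c -> (chain_norm a 1%g c < +oo)%E ->
    near_diagonal r' (h c) /\
    (chain_norm b 1%g (h c) <= (C * (fine (chain_norm a 1%g c) + 1))%:E)%E.

Lemma chain_norm_normalize n a (c : chain n) : index a ->
  (chain_norm a 1%g c < +oo)%E ->
  let t := (fine (chain_norm a 1%g c) + 1)^-1 in
  0 < t /\ (chain_norm a 1%g (t *: c)%R <= 1)%E.
Proof.
move=> Ia ac t; set N := fine (chain_norm a 1%g c) in t *.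
have N0 : 0 <= N by apply: fine_ge0; exact: chain_norm_ge0.
have N1 : 0 < N + 1 by rewrite ltr_wpDl.
have t0 : 0 < t by rewrite invr_gt0.
split=> //; rewrite chain_normZ// gtr0_norm//.
rewrite -(fineK (x := chain_norm _ _ _)) ?ge0_fin_numE ?chain_norm_ge0//.
by rewrite -EFinM lee_fin /t mulrC ler_pdivrMr// mul1r lerDl.
Qed.

(** A unit ball is bounded, so its image is bounded for some weight; the general case
    follows by scaling. *)
Lemma homotopy_tame_inductive n r : inductive_growth T ->
  tame T (@homotopy_estimate n r).
Proof.
move=> indT; rewrite /tame indT => a Ia.
pose F := [set c : chain n | [/\ reduced n c, near_diagonal r c
  & (chain_norm a 1%g c <= 1)%E]].
have bF : @chains_bounded R G S T n F.
  apply/chains_boundedE; split; first by exists r => c [].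
  by rewrite /space_quantifier indT; exists a => //; exists 1 => c [].
have /homotopy_bounded /(_ bF) /chains_boundedE[[r' rF]] : F `<=` reduced n.
  by move=> c [].
rewrite /space_quantifier indT => -[b Ib [M bM]]; exists b => //.
exists r', (Num.max M 0); split; first by rewrite le_max lexx orbT.
move=> c rc dc ac; have [t0 tc] := chain_norm_normalize Ia ac.
set t := _^-1 in t0 tc.
have Ftc : F (t *: c).
  by split=> //; [apply: reducedZ => //; exact: ltW|exact: near_diagonalZ].
have [rd nd] := homotopy_rescale t0 rc; split.
  by apply/rd/rF; exists (t *: c).
apply: le_trans (nd b M Ib (bM _ _)) _; first by exists (t *: c).
rewrite lee_fin invrK mulrC ler_wpM2r ?le_max ?lexx//.
by rewrite addr_ge0// fine_ge0// chain_norm_ge0.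
Qed.

(** If no estimate held, suitable multiples of a sequence of counterexamples would
    form a bounded set with unbounded image.  This is the usual proof that bounded
    linear maps between spaces topologized by a sequence of norms are continuous;
    here the support of [h c] is controlled by the same argument. *)
Lemma homotopy_tame_projective n r : ~~ inductive_growth T ->
  tame T (@homotopy_estimate n r).
Proof.
move=> projT; rewrite /tame (negbTE projT) => b Ib.
have [u Iu ucof] := cofinal_weights projT.
apply: contrapT => noa.
have bad k : exists c : chain n, [/\ reduced n c, near_diagonal r c,
    (chain_norm (u k) 1%g c < +oo)%E
    & ~ (near_diagonal k (h c) /\ (chain_norm b 1%g (h c) <=
         (k%:R * (fine (chain_norm (u k) 1%g c) + 1))%:E)%E)].
  apply: contrapT => nbad; apply: noa; exists (u k) => //; exists k, k%:R.
  split=> // c rc dc kc; apply: contrapT => nc; apply: nbad; by exists c.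
have {bad} [c cP] := choice bad.
(* [c k] violates the estimate for the weight [u k] with constant [k] *)
pose t k := (fine (chain_norm (u k) 1%g (c k)) + 1)^-1.
have tP k : 0 < t k /\ (chain_norm (u k) 1%g (t k *: c k)%R <= 1)%E.
  by have [_ _ kc _] := cP k; exact: chain_norm_normalize.
pose F := range (fun k => t k *: c k).
have Fr : F `<=` reduced n.
  move=> _ [k _ <-]; have [rc _ _ _] := cP k.
  by apply: reducedZ => //; apply: ltW; exact: (proj1 (tP k)).
have bF : @chains_bounded R G S T n F.
  apply/chains_boundedE; split.
    by exists r => _ [k _ <-]; have [_ dc _ _] := cP k; exact: near_diagonalZ.
  rewrite /space_quantifier (negbTE projT) => a Ia; have [K KP] := ucof a Ia.
  have fin k : chain_norm a 1%g (t k *: c k)%R \is a fin_num.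
    have Fk : F (t k *: c k) by exists k.
    have /(chainsE genS)[_] := reduced_chainsW (Fr _ Fk).
    rewrite /space_quantifier (negbTE projT) => /(_ a Ia) ak.
    by rewrite ge0_fin_numE// chain_norm_ge0.
  have fin0 k : 0 <= fine (chain_norm a 1%g (t k *: c k)%R).
    by apply: fine_ge0; exact: chain_norm_ge0.
  (* from [K] on, the norm for [u k] dominates the one for [a] *)
  exists (1 + \sum_(k < K) fine (chain_norm a 1%g (t k *: c k)%R)).
  move=> _ [k _ <-]; have [kK|Kk] := ltnP k K.
    rewrite -(fineK (fin k)) lee_fin (bigD1 (Ordinal kK))//= addrCA lerDl.
    by rewrite addr_ge0// sumr_ge0.
  apply: le_trans (chain_norm_mono _ _ _ Ia (Iu k) (KP k Kk)) _.
  apply: le_trans (proj2 (tP k)) _.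
  by rewrite lee_fin lerDl sumr_ge0.
have /chains_boundedE[[r' rF]] := homotopy_bounded Fr bF.
rewrite /space_quantifier (negbTE projT) => /(_ b Ib)[M bM].
(* the image is [r']-controlled with norms at most [M]; compare with index [k] *)
pose k := maxn r' (Num.truncn M).+1.
have [rc _ _ []] := cP k; have [t0 _] := tP k.
have [rd nd] := homotopy_rescale t0 rc.
have hF : (@h n @` F) (h (t k *: c k)) by exists (t k *: c k) => //; exists k.
split; first by apply: near_diagonal_leq (leq_maxl _ _) (rd _ (rF _ hF)).
apply: le_trans (nd b M Ib (bM _ hF)) _.
rewrite lee_fin invrK mulrC ler_wpM2r//.
  by rewrite addr_ge0// fine_ge0// chain_norm_ge0.
by rewrite (le_trans (ltW (truncnS_gt M)))// ler_nat leq_maxr.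
Qed.

Lemma homotopy_tame n r : tame T (@homotopy_estimate n r).
Proof.
by have [/homotopy_tame_inductive|/homotopy_tame_projective] :=
  boolP (inductive_growth T).
Qed.

(** ** The comparison map from the bar resolution *)

(** The given homotopy need not be equivariant.  Its conjugates form an equivariant
    family, indexed by the base point. *)
Definition based_homotopy (g : G) n (c : chain n) : chain n.+1 :=
  shift g (h (shift g^-1 c)).

(** In degree zero the recursion contracts only differences of two points, and these
    are visibly stable under translation. *)
Definition tempered_good n : set (chain n) :=
  match n return set (chain n) with
  | 0%N => [set c | exists b b', c = basis_chain R [tuple b] - basis_chain R [tuple b']]
  | m.+1 => @chains m.+1
  end.

Lemma shiftB g n (c d : chain n) : shift g (c - d) = shift g c - shift g d.
Proof. by []. Qed.

Lemma shiftK g n : cancel (@shift R G g n) (shift g^-1).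
Proof. by move=> c; apply/funext => x; rewrite /shift invgK translateK. Qed.

Lemma shiftVK g n : cancel (@shift R G g^-1 n) (shift g).
Proof. by move=> c; apply/funext => x; rewrite /shift invgK translateVK. Qed.

Lemma shift_shift g b n (c : chain n) : shift (g * b)%g c = shift g (shift b c).
Proof.
apply/funext => x; rewrite /shift; congr c; apply: eq_from_tnth => i.
by rewrite !tnth_translate invgM mulgA.
Qed.

Lemma tempered_good_shift g n (c : chain n) :
  tempered_good c -> tempered_good (shift g c).
Proof.
case: n c => [|n] c; last exact: chains_shift.
move=> [b [b' ->]]; exists (g * b)%g, (g * b')%g.
rewrite shiftB -!basis_chain_translate.
by congr (basis_chain R _ - basis_chain R _); exact: val_inj.
Qed.

Lemma tempered_good_reduced n (c : chain n) : tempered_good c -> reduced n c.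
Proof. by case: n c => [|n] c // [b [b' ->]]; exact: reduced_edge. Qed.

Lemma based_homotopy_chains g n (c : chain n) :
  tempered_good c -> chains (based_homotopy g c).
Proof.
move=> gc; apply/chains_shift/homotopy_chains/tempered_good_reduced => //.
exact: tempered_good_shift.
Qed.

Lemma based_homotopy0 g n : based_homotopy g (0 : chain n) = 0.
Proof. by rewrite /based_homotopy (_ : shift g^-1 0 = 0) ?homotopy0. Qed.

Lemma bd_based_homotopy0 g (c : chain 0) :
  tempered_good c -> bd (based_homotopy g c) = c.
Proof.
move=> gc; rewrite /based_homotopy bd_shift; have [_ bh _] := contract.
rewrite bh ?shiftVK//.
exact/tempered_good_reduced/tempered_good_shift.
Qed.

Lemma bd_based_homotopy g n (c : chain n.+1) : tempered_good c ->
  bd (based_homotopy g c) + based_homotopy g (bd c) = c.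
Proof.
move=> gc; rewrite /based_homotopy -bd_shift bd_shift; have [_ _ bh] := contract.
rewrite -[RHS](shiftVK g) -[in RHS](bh n (shift g^-1 c))//.
exact/tempered_good_reduced/tempered_good_shift.
Qed.

Lemma based_homotopy_shift g b n (c : chain n) :
  based_homotopy (g * b)%g (shift g c) = shift g (based_homotopy b c).
Proof.
by rewrite /based_homotopy shift_shift invgM shift_shift shiftK.
Qed.

Local Notation chain_mod := (fun n => chain n : zmodType).
Definition comparison := @model G chain_mod based_homotopy (@basis_chain R G).
Definition comparison_homotopy :=
  @model_homotopy G chain_mod based_homotopy (@basis_chain R G).

Let basis_good b c :
  tempered_good (basis_chain R [tuple b] - basis_chain R [tuple c]).
Proof. by exists b, c. Qed.

Lemma comparison_chains n x : chains (@comparison n x).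
Proof.
case: n x => [|n] x; first exact: chains_basis.
apply: (@good_model G chain_mod tempered_good) => //.
- by move=> m; exact: chains0.
- by move=> m c d; exact: chainsB.
- by move=> g m c; exact: based_homotopy_chains.
Qed.

Lemma bd_comparison n x : bd (@comparison n.+1 x) = alt_sum (@comparison n) x.
Proof.
apply: (@bd_model G chain_mod tempered_good _ _ (@bd R G)) => //.
- by move=> m; exact: chains0.
- by move=> m c d; exact: chainsB.
- by move=> m c d; exact: bdB.
- by move=> g m c; exact: based_homotopy_chains.
- exact: based_homotopy0.
- exact: bd_based_homotopy0.
- exact: bd_based_homotopy.
Qed.

Lemma comparison_homotopy_chains n x : chains (@comparison_homotopy n x).
Proof.
apply: (@good_model_homotopy G chain_mod tempered_good) => //.
- by move=> m; exact: chains0.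
- by move=> m c d; exact: chainsB.
- by move=> m y; exact: chains_basis.
- by move=> g m c; exact: based_homotopy_chains.
Qed.

Lemma bd_comparison_homotopy n x : bd (@comparison_homotopy n.+1 x) =
  @comparison n.+1 x - basis_chain R x - alt_sum (@comparison_homotopy n) x.
Proof.
apply: (@bd_model_homotopy G chain_mod tempered_good _ _ (@bd R G)) => //.
- by move=> m; exact: chains0.
- by move=> m c d; exact: chainsB.
- by move=> m c d; exact: bdB.
- by move=> m y; exact: chains_basis.
- by move=> m y; exact: bd_basis_chain.
- by move=> g m c; exact: based_homotopy_chains.
- exact: based_homotopy0.
- exact: bd_based_homotopy0.
- exact: bd_based_homotopy.
Qed.

Lemma comparison_translate g n x :
  @comparison n (translate g x) = shift g (comparison x).
Proof.
apply: (@model_translate G chain_mod _ _ (@shift R G)).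
- by move=> b m c d; exact: shiftB.
- by move=> b b' m c; exact: based_homotopy_shift.
- by move=> b m y; exact: basis_chain_translate.
Qed.

Lemma comparison_homotopy_translate g n x :
  @comparison_homotopy n (translate g x) = shift g (comparison_homotopy x).
Proof.
apply: (@model_homotopy_translate G chain_mod _ _ (@shift R G)).
- by move=> b m c d; exact: shiftB.
- by move=> b b' m c; exact: based_homotopy_shift.
- by move=> b m y; exact: basis_chain_translate.
Qed.

Definition comparison_estimate n (a b : R) : Prop :=
  exists r (C : R), [/\ 0 <= C, forall x, near_diagonal r (@comparison n x)
  & forall x : n.+1.-tuple G, (chain_norm b (thead x) (comparison x) <=
       (C * path_weight a (thead x) x)%:E)%E].

Lemma comparison_estimate_mono n : mono_rel T (@comparison_estimate n).
Proof.
move=> a a' b b' Ia Ia' Ib Ib' aa' b'b [r [C [C0 rc bc]]]; exists r, C; split=> // x.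
apply: le_trans (chain_norm_mono _ _ _ Ib' Ib b'b) _.
apply: le_trans (bc x) _; rewrite lee_fin ler_wpM2l//.
exact: path_weight_mono.
Qed.

Lemma near_diagonal_alt_sum r n m (A : n.+1.-tuple G -> chain m) x :
  (forall y, near_diagonal r (A y)) -> near_diagonal r (alt_sum A x).
Proof.
have nN c : near_diagonal r c -> near_diagonal r (- c : chain m).
  by move=> nc; rewrite -sub0r; apply: near_diagonalB.
move=> rA; apply: (big_ind (@near_diagonal r m)) => //.
  by move=> c d nc nd; rewrite -[d]opprK; apply: near_diagonalB => //; exact: nN.
by move=> j _; case: odd => //; exact: nN.
Qed.

Lemma chain_norm_alt_sum a p n m (A : n.+1.-tuple G -> chain m) x (M : R) :
  index a -> (forall j, (chain_norm a p (A (face j x)) <= M%:E)%E) ->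
  (chain_norm a p (alt_sum A x) <= (n.+2%:R * M)%:E)%E.
Proof.
move=> Ia AM; rewrite /alt_sum.
have -> : n.+2%:R * M = \sum_(j < n.+2) M by rewrite sumr_const card_ord mulr_natl.
apply: (big_ind2 (fun c (M : R) => (chain_norm a p c <= M%:E)%E)).
- by rewrite chain_norm0.
- move=> c M1 d M2 cM dM; rewrite -[d]opprK.
  apply: le_trans (chain_normB _ _ _ _ Ia) _.
  by rewrite chain_normN EFinD leeD.
- by move=> j _; case: odd; rewrite ?chain_normN.
Qed.

(** Faces that keep the first entry are estimated with the same base point.  The
    face that omits it has a new base point, and changing it back costs exactly the
    weight of the first step of the path. *)
Lemma comparison_tame n : tame T (@comparison_estimate n).
Proof.
elim: n => [|n IH].
  apply: (tameW _ (tame_ge T)) => a b Ia Ib _; exists 0%N, 1; split=> // x.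
    apply: near_diagonal_basis => i j.
    by rewrite !ord1 /word_dist mulVg word_length1.
  apply: le_trans (chain_norm_basis _ _ _ Ib) _.
  by rewrite mulVg weight1// mul1r lee_fin path_weight_ge1.
have [a0 [b0 [_ _ [r [_ [_ rF _]]]]]] := tame_inhabited IH.
pose arg (x : n.+2.-tuple G) : chain n :=
  shift (thead x)^-1 (alt_sum (@comparison n) x).
have arg_diag x : near_diagonal r (arg x).
  exact/near_diagonal_shift/near_diagonal_alt_sum.
have arg_red x : reduced n (arg x).
  apply/tempered_good_reduced/tempered_good_shift; 
    case: n {IH rF arg arg_diag} x => [|n] x.
    by have [b [c ->]] := tuple2_edge x; rewrite alt_sum_edge; exists c, b.
  by apply: chains_alt_sum => // y; exact: comparison_chains.
have argE : tame T (fun a b => exists2 C : R, 0 <= C & forall x,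
    (chain_norm b 1%g (arg x) <= (C * path_weight a (thead x) x)%:E)%E).
  apply: tameW (tame_and_ge (@comparison_estimate_mono n) IH).
  move=> a b Ia Ib [ba [r' [C [C0 _ bC]]]]; exists (n.+2%:R * C) => [|x].
    by rewrite mulr_ge0.
  rewrite -[1%g](mulVg (thead x)) chain_norm_shift -mulrA.
  apply: chain_norm_alt_sum => // j.
  apply: le_trans (chain_norm_base genS _ (thead (face j x)) _ Ib) _.
  apply: le_trans (lee_pmul _ _ (lexx _) (bC _)) _.
  - by rewrite lee_fin weight_ge0.
  - exact: chain_norm_ge0.
  rewrite -EFinM lee_fin mulrCA ler_wpM2l//.
  apply: le_trans (path_weight_face_thead genS j x Ia).
  by rewrite ler_wpM2r ?path_weight_ge0// weight_mono.
apply: tame_comp argE (homotopy_tame n r).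
move=> a b c Ia Ib Ic [C C0 aC] [r' [C' [C'0 hC]]].
have fin x : (chain_norm c 1%g (arg x) < +oo)%E.
  by apply: le_lt_trans (aC x) (ltry _).
exists r', (C' * (C + 1)); split=> [|x|x].
- by rewrite mulr_ge0// addr_ge0.
- by apply: near_diagonal_shift; have [] := hC _ (arg_red x) (arg_diag x) (fin x).
have [_] := hC _ (arg_red x) (arg_diag x) (fin x).
rewrite -{1}(chain_norm_shift S T b (thead x)) mulg1 => hx.
apply: le_trans hx _; rewrite lee_fin -mulrA ler_wpM2l// mulrDl mul1r lerD//.
  by rewrite -lee_fin fineK// ge0_fin_numE// chain_norm_ge0.
exact: path_weight_ge1.
Qed.

End Homotopy.
(** * Normalization of homogeneous cochains *)

Section Normalization.
Variables (R : realType) (G : groupType).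
Local Notation chain n := (n.+1.-tuple G -> R).
Local Notation functional := (fun n => (chain n -> R) : zmodType).

Definition slice b n (f : chain n.+1) : chain n := fun y => f [tuple of b :: y].

(** In degree zero a functional must also kill constants, as the difference of two
    evaluations does. *)
Definition additive_functional n : set (chain n -> R) :=
  [set c | (forall f g : chain n, c (f - g) = c f - c g) /\
           (n = 0%N -> forall k, c (cst k) = 0)].

Definition functional_boundary n (c : chain n.+1 -> R) : chain n -> R :=
  fun f => c (alt_sum f).

Definition functional_cone b n (c : chain n -> R) : chain n.+1 -> R :=
  fun f => c (slice b f).

Definition evaluation n (x : n.+1.-tuple G) : chain n -> R := fun f => f x.

Definition translated_functional g n (c : chain n -> R) : chain n -> R :=
  fun f => c (fun y => f (translate g y)).

Lemma slice_alt_sum0 b (f : chain 0) :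
  slice b (alt_sum f) = f - cst (f [tuple b]).
Proof.
apply/funext => y; have [c [z ->]] := tuple1_cons y; rewrite (tuple0 z).
exact: alt_sum_edge.
Qed.

Lemma slice_alt_sum b n (f : chain n.+1) :
  slice b (alt_sum f) = f - alt_sum (slice b f).
Proof. by apply/funext => y; exact: alt_sum_cons. Qed.

(** Chains on tuples are represented by the functionals that they define on all
    functions, with evaluations as basis and cones as contraction. *)
Definition normalizer := @model G functional functional_cone evaluation.
Definition normalizer_homotopy :=
  @model_homotopy G functional functional_cone evaluation.

Let good0 n : additive_functional (0 : chain n.+1 -> R).
Proof. by split=> // f g; rewrite subr0. Qed.

Let goodB n (c d : chain n.+1 -> R) : additive_functional c ->
  additive_functional d -> additive_functional (c - d).
Proof.
move=> [cB _] [dB _]; split=> // f g.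
have E k : (c - d) k = c k - d k by [].
by rewrite !E cB dB; ring.
Qed.

Let evaluation_edge b c :
  additive_functional (evaluation [tuple b] - evaluation [tuple c]).
Proof.
split=> [f g|_ k].
  rewrite -[LHS]/(f _ - g _ - (f _ - g _)) -[RHS]/(f _ - f _ - (g _ - g _)).
  by ring.
by rewrite -[LHS]/(k - k) subrr.
Qed.

Let additive_evaluation n (x : n.+2.-tuple G) : additive_functional (evaluation x).
Proof. by split. Qed.

Let boundary_evaluation n (x : n.+2.-tuple G) :
  functional_boundary (evaluation x) = alt_sum (@evaluation n) x.
Proof.
by apply/funext => f; rewrite alt_sum_fct.
Qed.

Let additive_cone b n (c : chain n -> R) : additive_functional c ->
  additive_functional (functional_cone b c).
Proof. by move=> [cB _]; split=> // f g; exact: cB. Qed.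

Let cone0 b n : functional_cone b (0 : chain n -> R) = 0.
Proof. by []. Qed.

Let boundary_cone0 b (c : chain 0 -> R) : additive_functional c ->
  functional_boundary (functional_cone b c) = c.
Proof.
move=> [cB c0]; apply/funext => f; rewrite /functional_boundary /functional_cone.
by rewrite slice_alt_sum0 cB c0// subr0.
Qed.

Let boundary_cone b n (c : chain n.+1 -> R) : additive_functional c ->
  functional_boundary (functional_cone b c) +
  functional_cone b (functional_boundary c) = c.
Proof.
move=> [cB _]; apply/funext => f.
rewrite -[LHS]/(c (slice b (alt_sum f)) + c (alt_sum (slice b f))).
by rewrite slice_alt_sum cB subrK.
Qed.

(** Replaces a cocycle by a cohomologous one that vanishes on degenerate tuples
    ([normalizeE], [normalize_degenerate]). *)
Definition normalize n (f : chain n) : chain n := fun x => normalizer x f.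
Definition normalize_homotopy n (f : chain n.+1) : chain n :=
  fun x => normalizer_homotopy x f.

Lemma normalize_alt_sum n (f : chain n) :
  normalize (alt_sum f) = alt_sum (normalize f).
Proof.
apply/funext => x; rewrite -(alt_sum_fct (@normalizer n) x f).
rewrite -(@bd_model G functional additive_functional _ _ functional_boundary
  _ functional_cone evaluation)//.
Qed.

Lemma normalizeE n (f : chain n.+1) :
  normalize f = f + alt_sum (normalize_homotopy f) + normalize_homotopy (alt_sum f).
Proof.
apply/funext => x.
have := @bd_model_homotopy G functional additive_functional _ _
  functional_boundary _ functional_cone evaluation evaluation_edge
  additive_evaluation boundary_evaluation additive_cone cone0 boundary_cone0
  boundary_cone n x.
move=> /(_ _ _ _)/(congr1 (fun c => c f)) E.
rewrite -[RHS]/(f x + alt_sum (normalize_homotopy f) x +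
  normalizer_homotopy x (alt_sum f)).
rewrite -(alt_sum_fct (@normalizer_homotopy n) x f).
rewrite -[normalizer_homotopy _ _]/(functional_boundary (normalizer_homotopy x) f) E//.
rewrite -[RHS]/(f x + alt_sum (@normalizer_homotopy n) x f +
  (normalizer x f - f x - alt_sum (@normalizer_homotopy n) x f)).
by rewrite -[normalize f x]/(normalizer x f); ring.
Qed.

Lemma normalizerS n (x : n.+2.-tuple G) (f : chain n.+1) :
  normalizer x f = alt_sum (normalize (slice (thead x) f)) x.
Proof. exact: alt_sum_fct. Qed.

Lemma normalize_degenerate n (f : chain n) x : degenerate x -> normalize f x = 0.
Proof.
elim: n f x => [|n IH] f x.
  by have [b [y ->]] := tuple1_cons x; rewrite (tuple0 y).
move=> dx; rewrite /normalize normalizerS alt_sum_degenerate// => y dy.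
exact: IH.
Qed.

Let cone_translate g b n (c : chain n -> R) :
  functional_cone (g * b)%g (translated_functional g c) =
  translated_functional g (functional_cone b c).
Proof.
apply/funext => f; congr c; apply/funext => y; congr f; exact: val_inj.
Qed.

Definition invariant n (f : n.-tuple G -> R) : Prop :=
  forall g x, f (translate g x) = f x.

Lemma invariant_normalize n (f : chain n) : invariant f -> invariant (normalize f).
Proof.
move=> invf g x; rewrite /normalize /normalizer.
rewrite (@model_translate G functional _ _ translated_functional)//.
by rewrite /translated_functional (_ : (fun y => f _) = f)//; exact/funext/invf.
Qed.

Lemma invariant_normalize_homotopy n (f : chain n.+1) :
  invariant f -> invariant (normalize_homotopy f).
Proof.
move=> invf g x; rewrite /normalize_homotopy /normalizer_homotopy.
rewrite (@model_homotopy_translate G functional _ _ translated_functional)//.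
by rewrite /translated_functional (_ : (fun y => f _) = f)//; exact/funext/invf.
Qed.

Lemma normalizer_homotopyS n (x : n.+2.-tuple G) (f : chain n.+2) :
  normalizer_homotopy x f = normalize (slice (thead x) f) x
    - slice (thead x) f x - alt_sum (normalize_homotopy (slice (thead x) f)) x.
Proof.
by rewrite -[in RHS](alt_sum_fct (@normalizer_homotopy n) x (slice (thead x) f)).
Qed.

Lemma ler_alt_sum n (f : chain n) x (M : R) :
  (forall j, `|f (face j x)| <= M) -> `|alt_sum f x| <= n.+2%:R * M.
Proof.
move=> fM; apply: le_trans (ler_norm_sum _ _ _) _.
have -> : n.+2%:R * M = \sum_(j < n.+2) M by rewrite sumr_const card_ord mulr_natl.
by apply: ler_sum => j _; case: odd; rewrite ?normrN.
Qed.

Section Growth.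
Variables (S : seq G).
Hypothesis genS : generates S.
Variables (T : growth R) (a : R).
Hypothesis Ia : weight_index T a.
Local Notation weight := (weight S T a).
Local Notation path_weight := (path_weight S T a).

Lemma slice_bound p D b n (f : chain n.+1) :
  (forall y, `|f y| <= D * path_weight p y) ->
  forall y, `|slice b f y| <= D * weight (p^-1 * b)%g * path_weight b y.
Proof. by move=> fD y; rewrite -mulrA; exact: fD. Qed.

Lemma path_weight_faces p b n j (x : n.+2.-tuple G) : b = thead x ->
  weight (p^-1 * b)%g * path_weight b (face j x) <= path_weight p x.
Proof.
move=> ->; rewrite [leRHS]path_weight_thead// ler_wpM2l ?weight_ge0//.
exact: path_weight_face.
Qed.

(** The base point of the paths is arbitrary here in order that the bound applies,
    inductively, to the slices of [f]. *)
Lemma normalize_bound n : exists2 C : R, 0 <= C &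
  forall p (D : R) (f : chain n), 0 <= D -> (forall y, `|f y| <= D * path_weight p y) ->
  forall x, `|normalize f x| <= C * D * path_weight p x.
Proof.
elim: n => [|n [C C0 IH]]; first by exists 1 => // p D f D0 fD x; rewrite mul1r fD.
exists (n.+2%:R * C) => [|p D f D0 fD x]; first by rewrite mulr_ge0.
rewrite /normalize normalizerS -!mulrA; apply: ler_alt_sum => j.
apply: le_trans (IH _ _ _ _ (slice_bound (thead x) fD) _) _.
  by rewrite mulr_ge0// weight_ge0.
rewrite -!mulrA; do 2!apply: ler_wpM2l => //.
exact: path_weight_faces.
Qed.

Lemma normalize_homotopy_bound n : exists2 C : R, 0 <= C &
  forall p (D : R) (f : chain n.+1), 0 <= D ->
  (forall y, `|f y| <= D * path_weight p y) ->
  forall x, `|normalize_homotopy f x| <= C * D * path_weight p x.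
Proof.
elim: n => [|n [C C0 IH]].
  by exists 0 => // p D f D0 fD x; rewrite !mul0r /normalize_homotopy /= normr0.
have [C' C'0 NC] := normalize_bound n.+1.
exists (C' + 1 + n.+2%:R * C) => [|p D f D0 fD x].
  by rewrite !addr_ge0// mulr_ge0.
have sD := slice_bound (thead x) fD.
have D'0 : 0 <= D * weight (p^-1 * thead x)%g by rewrite mulr_ge0// weight_ge0.
rewrite /normalize_homotopy normalizer_homotopyS.
set K := n.+2%:R * C; rewrite !mulrDl mul1r.
apply: le_trans (ler_normB _ _) _; apply: lerD.
  apply: le_trans (ler_normB _ _) _; apply: lerD.
    by rewrite [path_weight p x]path_weight_thead// mulrA -[C' * D * _]mulrA NC.
  by rewrite [path_weight p x]path_weight_thead// mulrA sD.
rewrite /K -!mulrA; apply: ler_alt_sum => j.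
apply: le_trans (IH _ _ _ D'0 sD _) _.
rewrite -!mulrA; do 2!apply: ler_wpM2l => //.
exact: path_weight_faces.
Qed.

End Growth.
End Normalization.

(** * Pulling back along the comparison map *)

Section Prism.
Variables (R : realType) (G : groupType) (S : seq G).
Hypothesis genS : generates S.
Variable T : growth R.
Local Notation index := (weight_index T).
Local Notation weight := (weight S T).
Local Notation path_weight := (path_weight S T).
Local Notation chain_norm := (chain_norm S T).
Local Notation close := (close S).
Local Notation near_diagonal := (near_diagonal S).
Local Notation chain n := (n.+1.-tuple G -> R).
Local Notation chains := (chains S T).
Local Notation pairable := (pairable S T).
Variable h : forall n, chain n -> chain n.+1.
Hypothesis contract : bounded_contracting_homotopy S T h.
Local Notation comparison := (comparison h).
Local Notation comparison_homotopy := (comparison_homotopy h).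

Definition normalized n (f : chain n) : Prop := forall y, degenerate y -> f y = 0.

Definition cochain_growth n (f : chain n) : Prop := dual_quantifier T (fun a =>
  exists2 C, 0 <= C & forall x, `|f x| <= C * path_weight a (thead x) x).

(** Paths start at the unit element here: unlike [cochain_growth], this condition
    is stable under slicing, on which [prism] relies. *)
Definition tempered n (f : chain n) : Prop := dual_quantifier T (fun a =>
  exists2 C, 0 <= C & forall x, `|f x| <= C * path_weight a 1%g x).

Lemma cochain_growth_tempered n (f : chain n) : cochain_growth f -> tempered f.
Proof.
apply: dual_quantifierW => a Ia [C C0 fC]; exists C => // x.
apply: le_trans (fC x) _; rewrite ler_wpM2l//.
exact: path_weight_thead_le.
Qed.

Lemma tempered_pairable n (f : chain n) : tempered f -> pairable f.
Proof.
move=> tf r; apply: dual_quantifierW tf => a Ia [C C0 fC].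
have r0 : 0 <= length_weight T a r by exact: le_trans (length_weight_ge1 _ Ia).
exists (C * length_weight T a r ^+ n) => [|x rx].
  by rewrite mulr_ge0// exprn_ge0.
apply: le_trans (fC x) _; rewrite -mulrA ler_wpM2l//.
rewrite path_weight_thead// invg1 mul1g mulrC ler_wpM2r ?weight_ge0//.
exact: path_weight_close.
Qed.

Lemma tempered_alt_sum n (f : chain n) : tempered f -> tempered (alt_sum f).
Proof.
apply: dual_quantifierW => a Ia [C C0 fC]; exists (n.+2%:R * C) => [|x].
  by rewrite mulr_ge0.
rewrite -mulrA; apply: ler_alt_sum => j; apply: le_trans (fC _) _.
by rewrite ler_wpM2l// path_weight_face.
Qed.

Lemma tempered_slice b n (f : chain n.+1) : tempered f -> tempered (slice b f).
Proof.
apply: dual_quantifierW => a Ia [C C0 fC].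
exists (C * weight a b * weight a b^-1) => [|x].
  by rewrite !mulr_ge0// weight_ge0.
apply: le_trans (slice_bound b fC x) _; rewrite invg1 mul1g -!mulrA.
rewrite !ler_wpM2l ?weight_ge0// -[b^-1%g]mulg1.
exact: path_weight_base.
Qed.

Lemma normalized_slice b n (f : chain n.+1) : normalized f -> normalized (slice b f).
Proof. by move=> nf y dy; apply: nf; exact: degenerate_behead. Qed.

Definition pull n (f : chain n) : chain n := fun x => pairing (comparison x) f.

Lemma pairing_alt_sum n m (A : n.+1.-tuple G -> chain m) x (f : chain m) :
  (forall y, chains (A y)) -> pairable f ->
  pairing (alt_sum A x) f = alt_sum (fun y => pairing (A y) f) x.
Proof.
move=> cA pf.
have pN (c : chain m) : chains c -> pairing (- c) f = - pairing c f.
  move=> cc; rewrite -sub0r (pairingBl genS _ cc pf) ?pairing0l ?sub0r//.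
  exact: chains0.
suff [] : pairing (alt_sum A x) f = alt_sum (fun y => pairing (A y) f) x /\
  chains (alt_sum A x) by [].
apply: (big_ind2 (fun c (s : R) => pairing c f = s /\ chains c)).
- by split; [exact: pairing0l|exact: chains0].
- move=> c _ d _ [<- cc] [<- cd]; rewrite -{1 3}[d]opprK; split.
    by rewrite (pairingBl genS cc (chainsN genS cd) pf) pN// opprK.
  by apply: chainsB => //; exact: chainsN.
- by move=> j _; case: odd; split; [exact: pN|exact: chainsN| |].
Qed.

Lemma pull_alt_sum n (f : chain n) : pairable f -> normalized f ->
  pull (alt_sum f) = alt_sum (pull f).
Proof.
move=> pf nf; apply/funext => x; rewrite /pull.
rewrite -(pairing_bd genS _ pf nf); last exact: comparison_chains.
rewrite (bd_comparison genS contract) pairing_alt_sum// => y.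
exact: comparison_chains.
Qed.

Lemma invariant_pull n (f : chain n) : invariant f -> invariant (pull f).
Proof.
move=> invf g x; rewrite /pull comparison_translate pairing_shift.
by congr pairing; apply/funext => y; exact: invf.
Qed.

Lemma pairing_bound r b p n (c f : chain n) (E M : R) : index b -> 0 <= E ->
  near_diagonal r c -> (chain_norm b p c <= M%:E)%E ->
  (forall y, close r y -> `|f y| <= E * weight b (p^-1 * thead y)%g) ->
  `|pairing c f| <= E * M.
Proof.
move=> Ib E0 [rc _] cM fE.
apply: (@ler_real_sum _ _ _ (fun y => E * (`|c y| * weight b (p^-1 * thead y)%g))).
  move=> y; rewrite normrM mulrCA.
  have [/rc ->|ry] := pselect (~ close r y); first by rewrite normr0 !mul0r.
  by apply: ler_wpM2l => //; apply: fE; exact: contrapT.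
rewrite esumZ//; last by move=> y; rewrite mulr_ge0// weight_ge0.
rewrite EFinM; apply: lee_pmul => //; exact: chain_norm_ge0.
Qed.

(** Up to translation there are only finitely many tuples of bounded diameter. *)
Lemma invariant_bounded r n (f : chain n) : invariant f ->
  exists2 E, 0 <= E & forall y, close r y -> `|f y| <= E.
Proof.
move=> invf; pose A := [set z : n.-tuple G | close r [tuple of 1%g :: z]].
have finA : finite_set A by exact: finite_close_cons.
exists (\sum_(z \in A) `|f [tuple of 1%g :: z]|).
  by apply: fsumr_ge0.
move=> y; have [b [z ->]] := tuple1_cons y => ry.
pose z' := translate b^-1 z.
have yE : [tuple of b :: z] = translate b [tuple of 1%g :: z'].
  by apply: val_inj => /=; rewrite mulg1 -[in LHS](translateVK b z).
move: ry; rewrite yE invf => /close_translate rz.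
rewrite (fsbigD1 z' _ _ finA rz) /=.
by rewrite lerDl; apply: fsumr_ge0.
Qed.

Lemma invariant_pairable n (f : chain n) : invariant f -> pairable f.
Proof.
move=> invf r; have [E E0 fE] := invariant_bounded r invf.
have H a : index a -> exists2 D : R, 0 <= D &
    forall x, close r x -> `|f x| <= D * weight a (thead x).
  move=> Ia; exists E => // x rx; apply: le_trans (fE x rx) _.
  by rewrite ler_peMr// weight_ge1.
have [a Ia] := weight_index_nonempty T.
by rewrite /dual_quantifier; case: inductive_growth => //; exists a => //; exact: H.
Qed.

(** Only the values of [f] near the diagonal matter, and up to translation there
    are finitely many of them; so [f] may grow arbitrarily fast. *)
Lemma pull_growth n (f : chain n) : invariant f -> cochain_growth (pull f).
Proof.
move=> invf; apply: tame_dual_quantifier (comparison_tame genS contract n).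
move=> a b Ia Ib [r [C [C0 rC bC]]].
have [E E0 fE] := invariant_bounded r invf; exists (E * C) => [|x].
  exact: mulr_ge0.
rewrite -mulrA; apply: pairing_bound (rC x) (bC x) _ => // y ry.
by apply: le_trans (fE y ry) _; rewrite ler_peMr// weight_ge1.
Qed.

Definition pull_homotopy n (f : chain n.+1) : chain n :=
  fun x => pairing (comparison_homotopy x) f.

Lemma invariant_pull_homotopy n (f : chain n.+1) :
  invariant f -> invariant (pull_homotopy f).
Proof.
move=> invf g x; rewrite /pull_homotopy comparison_homotopy_translate pairing_shift.
by congr pairing; apply/funext => y; exact: invf.
Qed.

(** The comparison map is homotopic to the map that sends a tuple to its
    characteristic function, and pulling back along the latter does nothing. *)
Lemma pullE n (f : chain n.+1) : pairable f -> normalized f -> alt_sum f = 0 ->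
  pull f = f + alt_sum (pull_homotopy f).
Proof.
move=> pf nf f0; apply/funext => x.
have cH m (y : m.+1.-tuple G) : chains (comparison_homotopy y).
  exact: comparison_homotopy_chains.
have cC m (y : m.+1.-tuple G) : chains (comparison y) by exact: comparison_chains.
have cb : chains (comparison x - basis_chain R x).
  by apply: chainsB => //; exact: chains_basis.
have ca : chains (alt_sum (@comparison_homotopy n) x).
  exact: chains_alt_sum.
have := pairing_bd genS (cH _ x) pf nf; rewrite f0 pairing0r.
rewrite (bd_comparison_homotopy genS contract) (pairingBl genS cb ca pf).
rewrite (pairingBl genS (cC _ x) (chains_basis genS T x) pf).
rewrite pairing_basis// pairing_alt_sum// => /eqP.
by rewrite subr_eq0 subr_eq addrC => /eqP.
Qed.

(** The dual of the prism operator x |-> sum_i (-1)^i (x_0, ..., x_i,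
    comparison(x_i, ..., x_n)), expanded with respect to the first entry. *)
Fixpoint prism n : chain n.+1 -> chain n :=
  if n isn't m.+1 then fun f x => pairing (comparison x) (slice (thead x) f)
  else fun f x => pairing (comparison x) (slice (thead x) f)
                  - @prism m (slice (thead x) f) [tuple of behead x].

Lemma prism_cons n (f : chain n.+2) b (z : n.+1.-tuple G) :
  prism f [tuple of b :: z] =
  pairing (comparison [tuple of b :: z]) (slice b f) - prism (slice b f) z.
Proof.
rewrite /= theadE; congr (_ - prism _ _); exact: val_inj.
Qed.

Lemma prismB n (f g : chain n.+1) x : tempered f -> tempered g ->
  prism (f - g) x = prism f x - prism g x.
Proof.
have cC m (y : m.+1.-tuple G) : chains (comparison y) by exact: comparison_chains.
have sB m b (f' g' : chain m.+1) : slice b (f' - g') = slice b f' - slice b g' by [].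
have sp m b (f' : chain m.+1) : tempered f' -> pairable (slice b f').
  by move=> tf; exact/tempered_pairable/tempered_slice.
elim: n f g x => [|n IH] f g x tf tg.
  by rewrite /= sB (pairingBr genS (cC _ x))//; exact: sp.
have [b [z ->]] := tuple1_cons x; rewrite !prism_cons sB.
rewrite IH; [|exact: tempered_slice|exact: tempered_slice].
rewrite (pairingBr genS (cC _ _)); [|exact: sp|exact: sp].
by ring.
Qed.

Lemma prism_slice_alt_sum n (f : chain n.+1) b x : tempered f -> normalized f ->
  pairing (comparison x) (slice b (alt_sum f)) =
  pull f x - alt_sum (pull (slice b f)) x.
Proof.
move=> tf nf; have tk := tempered_slice b tf; have nk := normalized_slice b nf.
have pk := tempered_pairable tk.
rewrite slice_alt_sum (@pairingBr _ _ _ genS T).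
- by rewrite -(pull_alt_sum pk nk).
- exact: comparison_chains.
- exact: tempered_pairable.
- exact/tempered_pairable/tempered_alt_sum.
Qed.

(** The homotopy identity for the prism operator.  It is not restricted to
    cocycles because slices of cocycles are not cocycles, so the induction needs
    the general case. *)
Lemma prism_alt_sum n (f : chain n) x : tempered f -> normalized f ->
  prism (alt_sum f) x + (match n return chain n -> chain n with
    | 0%N => fun _ _ => 0
    | m.+1 => fun f => alt_sum (@prism m f)
    end) f x = pull f x - f x.
Proof.
elim: n f x => [|n IH] f x tf nf; have [b [z ->]] := tuple1_cons x.
  have n0 (y : 1.-tuple G) : degenerate y = false.
    by have [c [t ->]] := tuple1_cons y; rewrite (tuple0 t).
  rewrite addr0 /= theadE /pull !pairing_basis; try by move=> y; rewrite n0.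
  by rewrite slice_alt_sum0 (tuple0 z) -[LHS]/(f _ - f _) !subrr.
have tk := tempered_slice b tf; have nk := normalized_slice b nf.
have := IH (slice b f) z tk nk; rewrite -[slice b f z]/(f _) => {}IH.
rewrite prism_cons slice_alt_sum prismB//; last exact: tempered_alt_sum.
rewrite -slice_alt_sum prism_slice_alt_sum//.
case: n f x z IH tf nf tk nk => [|n] f x z IH tf nf tk nk.
  move: IH; rewrite addr0; have [c [t ->]] := tuple1_cons z; rewrite (tuple0 t) => ->.
  rewrite !alt_sum_edge /= !theadE -[pull _ [tuple b]]/(pairing _ _).
  by ring.
rewrite !alt_sum_cons.
rewrite [alt_sum (fun t => prism f _) z](eq_alt_sum (B := fun t =>
  pull (slice b f) [tuple of b :: t] - prism (slice b f) t)); last first.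
  by move=> t; exact: prism_cons.
rewrite (alt_sumB (fun t => pull (slice b f) [tuple of b :: t])).
move/eqP: IH; rewrite eq_sym subr_eq => /eqP ->.
by ring.
Qed.

Lemma prism_translate g n (f : chain n.+1) x :
  prism f (translate g x) = prism (fun y => f (translate g y)) x.
Proof.
have sl m b (f' : chain m.+1) : (fun y => slice (g * b)%g f' (translate g y)) =
    slice b (fun y => f' (translate g y)).
  by apply/funext => y; congr f'; exact: val_inj.
elim: n f x => [|n IH] f x.
  by rewrite /prism comparison_translate pairing_shift thead_translate sl.
have [b [z ->]] := tuple1_cons x.
have -> : translate g [tuple of b :: z] = [tuple of (g * b)%g :: translate g z].
  exact: val_inj.
rewrite !prism_cons IH !sl.
have -> : [tuple of (g * b)%g :: translate g z] = translate g [tuple of b :: z].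
  exact: val_inj.
by rewrite comparison_translate pairing_shift sl.
Qed.

Lemma invariant_prism n (f : chain n.+1) : invariant f -> invariant (prism f).
Proof.
by move=> invf g x; rewrite prism_translate (_ : (fun y => _) = f)//; exact/funext/invf.
Qed.

Definition prism_estimate n (a b : R) : Prop := exists2 C, 0 <= C &
  forall p (D : R) (f : chain n.+1), 0 <= D ->
  (forall y, `|f y| <= D * path_weight b p y) ->
  forall x, `|prism f x| <= C * D * path_weight a p x.

Lemma prism_estimate_mono n : mono_rel T (@prism_estimate n).
Proof.
move=> a a' b b' Ia Ia' Ib Ib' aa' b'b [C C0 bC]; exists C => // p D f D0 fD x.
have fD' y : `|f y| <= D * path_weight b p y.
  by apply: le_trans (fD y) _; rewrite ler_wpM2l// path_weight_mono.
apply: le_trans (bC p D f D0 fD' x) _.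
by rewrite ler_wpM2l ?mulr_ge0// path_weight_mono.
Qed.

Lemma pairing_slice_bound n a b : index a -> index b -> b <= a ->
  comparison_estimate S T h n a b -> exists2 C, 0 <= C &
  forall p (D : R) (f : chain n.+1), 0 <= D ->
  (forall y, `|f y| <= D * path_weight b p y) ->
  forall x, `|pairing (comparison x) (slice (thead x) f)| <= C * D * path_weight a p x.
Proof.
move=> Ia Ib ba [r [C [C0 rC bC]]].
have r0 : 0 <= length_weight T b r by exact: le_trans (length_weight_ge1 _ Ib).
exists (length_weight T b r ^+ n * C) => [|p D f D0 fD x].
  by rewrite mulr_ge0// exprn_ge0.
set w := weight b (p^-1 * thead x)%g.
have w0 : 0 <= w by exact: weight_ge0.
apply: (@le_trans _ _ (D * w * length_weight T b r ^+ n *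
    (C * path_weight a (thead x) x))).
  apply: pairing_bound (rC x) (bC x) _ => //.
    by rewrite !mulr_ge0// exprn_ge0.
  move=> y ry; apply: le_trans (slice_bound (thead x) fD y) _.
  rewrite -!mulrA ler_wpM2l// ler_wpM2l// path_weight_thead// mulrC.
  by rewrite ler_wpM2r ?weight_ge0// path_weight_close.
rewrite [path_weight a p x]path_weight_thead//.
have -> : D * w * length_weight T b r ^+ n * (C * path_weight a (thead x) x) =
    length_weight T b r ^+ n * C * D * (w * path_weight a (thead x) x) by ring.
rewrite ler_wpM2l// ?mulr_ge0 ?exprn_ge0//.
by rewrite ler_wpM2r ?path_weight_ge0// weight_mono.
Qed.

(** Each summand of the prism first follows the path of the tuple and then continues
    with a value of [comparison] based at the point that it has reached.  So its
    total weight is bounded by that of the whole path. *)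
Lemma prism_tame n : tame T (@prism_estimate n).
Proof.
have est m := tame_and_ge (@comparison_estimate_mono _ _ _ T h m)
  (comparison_tame genS contract m).
elim: n => [|n IH].
  apply: tameW (est 0%N) => a b Ia Ib [ba /(pairing_slice_bound Ia Ib ba)[C C0 bC]].
  by exists C.
apply: tameW (tame_and_ge _ (tame_and (@comparison_estimate_mono _ _ _ T h n.+1)
  (@prism_estimate_mono n) (comparison_tame genS contract n.+1) IH)).
  move=> a b Ia Ib [ba [/(pairing_slice_bound Ia Ib ba)[C C0 bC] [C' C'0 bC']]].
  exists (C + C'); first exact: addr_ge0.
  move=> p D f D0 fD x; have := bC p D f D0 fD x.
  have [b' [z ->]] := tuple1_cons x; rewrite theadE => bCx.
  rewrite prism_cons !mulrDl; apply: le_trans (ler_normB _ _) _.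
  apply: lerD; first exact: bCx.
  apply: le_trans (bC' b' _ _ _ (slice_bound b' fD) z) _.
    by rewrite mulr_ge0// weight_ge0.
  rewrite -!mulrA; do 2!apply: ler_wpM2l => //.
  by rewrite ler_wpM2r ?path_weight_ge0// weight_mono.
move=> a a' b b' Ia Ia' Ib Ib' aa' b'b [E1 E2]; split.
  by apply: comparison_estimate_mono E1.
by apply: prism_estimate_mono E2.
Qed.

Lemma prism_growth n (f : chain n.+1) : cochain_growth f -> cochain_growth (prism f).
Proof.
apply: dual_quantifier_tame (tame_and_ge (@prism_estimate_mono n) (prism_tame n)).
move=> a b Ia Ib [ba [C C0 aC]] [D D0 fD]; exists (C * D) => [|x].
  exact: mulr_ge0.
apply: aC => // y; apply: le_trans (fD y) _; rewrite ler_wpM2l//.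
exact: path_weight_thead_le.
Qed.

End Prism.
(** * Homogeneous and inhomogeneous cochains *)

Section Homogeneous.
Variables (R : realType) (G : groupType).
Local Notation chain n := (n.+1.-tuple G -> R).
Local Notation cochain := (cochain R G).

Definition increments n (x : n.+1.-tuple G) : n.-tuple G :=
  [tuple of pairmap (fun b c => b^-1 * c)%g (thead x) (behead x)].

Definition partial_products n (g : n.-tuple G) : n.+1.-tuple G :=
  [tuple of 1%g :: scanl (fun b c => b * c)%g 1%g g].

Definition homogenize n (phi : cochain n) : chain n := fun x => phi (increments x).
Definition dehomogenize n (f : chain n) : cochain n := fun g => f (partial_products g).

Lemma incrementsK n : cancel (@partial_products n) (@increments n).
Proof.
move=> g; apply: val_inj => /=; rewrite theadE.
exact: (scanlK (fun b => mulKg b)).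
Qed.

Lemma partial_productsK n (x : n.+1.-tuple G) :
  translate (thead x) (partial_products (increments x)) = x.
Proof.
apply: val_inj; have [b [y ->]] := tuple1_cons x; rewrite /= theadE mulg1.
congr (_ :: _); have shift_scan (s : seq G) (g c : G) :
    [seq (g * d)%g | d <- scanl (fun b c => b * c)%g c s] =
    scanl (fun b c => b * c)%g (g * c)%g s.
  by elim: s c => //= d s IH c; rewrite IH mulgA.
rewrite shift_scan mulg1.
exact: (pairmapK (fun b => mulVKg b)).
Qed.

Lemma homogenizeK n : cancel (@homogenize n) (@dehomogenize n).
Proof.
by move=> phi; apply/funext => g; rewrite /dehomogenize /homogenize incrementsK.
Qed.

Lemma dehomogenizeK n (f : chain n) : invariant f -> homogenize (dehomogenize f) = f.
Proof.
move=> invf; apply/funext => x; rewrite /dehomogenize /homogenize.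
by rewrite -[in RHS](partial_productsK x) invf.
Qed.

Lemma tnth_increments n (x : n.+1.-tuple G) (i : 'I_n) :
  tnth (increments x) i = ((nth 1 x i)^-1 * nth 1 x i.+1)%g.
Proof.
have [b [y ->]] := tuple1_cons x.
by rewrite (tnth_nth 1%g) /= theadE (nth_pairmap 1%g) ?size_tuple.
Qed.

Lemma invariant_homogenize n (phi : cochain n) : invariant (homogenize phi).
Proof.
move=> g x; rewrite /homogenize; congr phi; apply: eq_from_tnth => i.
rewrite !tnth_increments /= !(nth_map 1%g) ?size_tuple ?ltnS ?(ltnW (ltn_ord i))//.
by rewrite invgM -mulgA mulKg.
Qed.

Lemma nth_face n (j : 'I_n.+2) (x : n.+2.-tuple G) k : (k < n.+1)%N ->
  nth 1%g (face j x) k = nth 1%g x (bump j k).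
Proof.
move=> kn; rewrite -(tnth_nth 1%g (face j x) (Ordinal kn)) tnth_mktuple.
by rewrite (tnth_nth 1%g).
Qed.

Lemma homogenize_cobd n (phi : cochain n) :
  homogenize (cobd phi) = alt_sum (homogenize phi).
Proof.
apply/funext => x; rewrite /homogenize /cobd /alt_sum.
under [RHS]eq_bigr do rewrite -(mulr_sign (odd _)) signr_odd.
rewrite big_ord_recl big_ord_recr /= expr0 mul1r addrA.
congr (phi _ + _ + _ * phi _).
- apply: eq_from_tnth => i; rewrite !tnth_increments tnth_mktuple tnth_increments.
  by rewrite !nth_face ?ltnS// ltnW.
- apply: eq_bigr => j _; congr (_ * phi _).
  apply: eq_from_tnth => i; rewrite tnth_mktuple !tnth_increments.
  rewrite !nth_face ?ltnS//; last by rewrite ltnW.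
  rewrite !lift_max !lift0 /= -val_eqE /= /bump /= ltnS.
  case: ltngtP => ij; rewrite ?add0n ?add1n//.
  by rewrite -mulgA mulVKg.
- apply: eq_from_tnth => i; rewrite !tnth_increments tnth_mktuple tnth_increments.
  rewrite !nth_face ?ltnS//; last by rewrite ltnW.
  by rewrite !lift_max /bump /= leqNgt ltnS ltnW// ltnNge ltn_ord.
Qed.

Lemma homogenizeB n (phi psi : cochain n) :
  homogenize (phi - psi) = homogenize phi - homogenize psi.
Proof. by []. Qed.

End Homogeneous.
(** * Cohomology *)

Section GrowthOfCochains.
Variables (R : realType) (G : groupType) (S : seq G).
Hypothesis genS : generates S.
Variable T : growth R.
Local Notation weight := (weight S T).
Local Notation path_weight := (path_weight S T).
Local Notation chain n := (n.+1.-tuple G -> R).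

Lemma has_growthE n (phi : cochain R G n) : has_growth S T phi <->
  dual_quantifier T (fun a => exists2 C, 0 < C & forall g,
    `|phi g| <= C * \prod_(i < n) weight a (tnth g i)).
Proof.
rewrite /has_growth /dual_quantifier /poly_growth /exp_growth /weight /length_weight
  /weight_index; case: T => [|k||] /=.
- by split=> -[a a1 [C C0 hC]]; exists a => //; exists C => // g;
    have := hC g; rewrite expr_sum.
- by split=> [hk|[a -> hk]] //; exists k%:num.
- by split=> [[k hk]|[_ [k _ <-] hk]]; [exists k%:R => //; exists k|exists k].
- by split=> hC a /hC [C C0 {}hC]; exists C => // g; have := hC g; rewrite expr_sum.
Qed.

(** Path weights are the bounding functions in the growth conditions. *)
Lemma path_weight_increments a n (x : n.+1.-tuple G) :
  path_weight a (thead x) x = \prod_(i < n) weight a (tnth (increments x) i).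
Proof.
rewrite -(big_tuple _ _ (increments x) xpredT (weight a)).
have [b [y ->]] := tuple1_cons x; rewrite /= theadE mulVg weight1// mul1r.
by elim: (tval y) b => [|c s IH] b /=; rewrite ?big_nil// big_cons IH.
Qed.

Lemma has_growth_homogenize n (phi : cochain R G n) :
  has_growth S T phi <-> cochain_growth S T (homogenize phi).
Proof.
rewrite has_growthE; split; apply: dual_quantifierW => a Ia [C C0 hC].
  exists C => [|x]; first exact: ltW.
  by rewrite path_weight_increments; exact: hC.
exists (C + 1) => [|g]; first by rewrite ltr_wpDl.
rewrite -[in leLHS](incrementsK g) -[phi _]/(homogenize phi _).
apply: le_trans (hC _) _; rewrite path_weight_increments incrementsK.
rewrite ler_wpM2r ?lerDl//; apply: prodr_ge0 => i _; exact: weight_ge0.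
Qed.

Lemma cochain_growthB n (f g : chain n) : cochain_growth S T f ->
  cochain_growth S T g -> cochain_growth S T (f - g).
Proof.
apply: dual_quantifier_and.
- move=> a b Ia Ib ab [C C0 fC]; exists C => // x.
  by apply: le_trans (fC x) _; rewrite ler_wpM2l// path_weight_mono.
- move=> a b Ia Ib ab [C C0 fC]; exists C => // x.
  by apply: le_trans (fC x) _; rewrite ler_wpM2l// path_weight_mono.
move=> a Ia [C C0 fC] [D D0 gD]; exists (C + D) => [|x]; first exact: addr_ge0.
by rewrite mulrDl (le_trans (ler_normB _ _))// lerD.
Qed.

Lemma normalize_growth n (f : chain n) : cochain_growth S T f ->
  cochain_growth S T (normalize f).
Proof.
apply: dual_quantifierW => a Ia [C C0 fC].
have [D D0 ND] := normalize_bound genS Ia n; exists (D * C) => [|x].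
  exact: mulr_ge0.
apply: ND => // y; apply: le_trans (fC y) _; rewrite ler_wpM2l//.
exact: path_weight_thead_le.
Qed.

Lemma normalize_homotopy_growth n (f : chain n.+1) : cochain_growth S T f ->
  cochain_growth S T (normalize_homotopy f).
Proof.
apply: dual_quantifierW => a Ia [C C0 fC].
have [D D0 ND] := normalize_homotopy_bound genS Ia n; exists (D * C) => [|x].
  exact: mulr_ge0.
apply: ND => // y; apply: le_trans (fC y) _; rewrite ler_wpM2l//.
exact: path_weight_thead_le.
Qed.

Lemma invariantB n (f g : chain n) : invariant f -> invariant g -> invariant (f - g).
Proof. by move=> fi gi b x; rewrite -[LHS]/(f _ - g _) fi gi. Qed.

Lemma invariantD n (f g : chain n) : invariant f -> invariant g -> invariant (f + g).
Proof. by move=> fi gi b x; rewrite -[LHS]/(f _ + g _) fi gi. Qed.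

Lemma alt_sum_funB n (f g : chain n) : alt_sum (f - g) = alt_sum f - alt_sum g.
Proof. by apply/funext => x; exact: alt_sumB. Qed.

Lemma alt_sum_funD n (f g : chain n) : alt_sum (f + g) = alt_sum f + alt_sum g.
Proof. by apply/funext => x; exact: alt_sumD. Qed.

Lemma alt_sum_fun_alt_sum n (f : chain n) : alt_sum (alt_sum f) = 0.
Proof. by apply/funext => x; exact: alt_sum_alt_sum. Qed.

Lemma normalize0 n : normalize (0 : chain n) = 0.
Proof.
apply/funext => x; elim: n x => [//|n IH] x.
rewrite /normalize normalizerS -[slice _ 0]/(0 : chain n).
by rewrite (eq_alt_sum IH) alt_sum0.
Qed.

Lemma normalize_homotopy0 n : normalize_homotopy (0 : chain n.+1) = 0.
Proof.
apply/funext => x; elim: n x => [//|n IH] x.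
rewrite /normalize_homotopy normalizer_homotopyS -[slice _ 0]/(0 : chain n.+1).
by rewrite normalize0 (eq_alt_sum IH) alt_sum0 !subr0.
Qed.

Lemma normalize_cocycle n (f : chain n.+1) : alt_sum f = 0 ->
  normalize f = f + alt_sum (normalize_homotopy f) /\ alt_sum (normalize f) = 0.
Proof.
move=> f0; split; first by rewrite normalizeE f0 normalize_homotopy0 addr0.
by rewrite -normalize_alt_sum f0 normalize0.
Qed.

Variable h : forall n, chain n -> chain n.+1.
Hypothesis contract : bounded_contracting_homotopy S T h.

(** The values of the comparison map are supported in one neighbourhood of the
    diagonal, on which an invariant function is bounded. *)
Lemma cocycle_growth_representative n (f : chain n.+1) :
  invariant f -> alt_sum f = 0 ->
  exists f' e : _, [/\ invariant f', cochain_growth S T f', invariant e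
    & f' = f + alt_sum e].
Proof.
move=> fi f0; have [Nf N0] := normalize_cocycle f0.
have Ni := invariant_normalize fi.
exists (pull h (normalize f)),
  (normalize_homotopy f + pull_homotopy h (normalize f)).
split.
- exact: invariant_pull.
- exact: pull_growth.
- by apply: invariantD;
    [exact: invariant_normalize_homotopy|exact: invariant_pull_homotopy].
rewrite (pullE genS contract)//.
- by rewrite {1}Nf alt_sum_funD addrA.
- exact: invariant_pairable.
- by move=> y; exact: normalize_degenerate.
Qed.

(** The three terms of the new primitive account for passing from [f] to its
    normalization, from there to the pull-back, and for the pull-back of [e]. *)
Lemma coboundary_growth_primitive n (f : chain n.+1) (e : chain n) :
  invariant f -> cochain_growth S T f -> invariant e -> f = alt_sum e ->
  exists2 e', invariant e' /\ cochain_growth S T e' & f = alt_sum e'.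
Proof.
move=> fi fg ei fE; have f0 : alt_sum f = 0 by rewrite fE alt_sum_fun_alt_sum.
have [Nf N0] := normalize_cocycle f0.
have Ng := normalize_growth fg.
have tN := cochain_growth_tempered Ng.
have nN : normalized (normalize f) by move=> y; exact: normalize_degenerate.
have nE : normalized (normalize e) by move=> y; exact: normalize_degenerate.
exists (pull h (normalize e) - prism h (normalize f) - normalize_homotopy f).
  split.
    apply: invariantB; last exact: invariant_normalize_homotopy.
    by apply: invariantB; [apply/invariant_pull/invariant_normalize|
      exact/invariant_prism/invariant_normalize].
  apply: cochain_growthB; last exact: normalize_homotopy_growth.
  apply: cochain_growthB; last exact: prism_growth.
  exact/pull_growth/invariant_normalize.
rewrite 2!alt_sum_funB.
have -> : alt_sum (prism h (normalize f)) = pull h (normalize f) - normalize f.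
  apply/funext => x; rewrite -[RHS](prism_alt_sum genS contract x tN nN) N0.
  have t0 : tempered S T (0 : chain n.+2).
    by rewrite -N0; exact: tempered_alt_sum.
  by have := prismB genS contract x t0 t0; rewrite subr0 subrr => ->; rewrite add0r.
have -> : alt_sum (pull h (normalize e)) = pull h (normalize f).
  rewrite fE normalize_alt_sum (pull_alt_sum genS contract)//.
  exact/invariant_pairable/invariant_normalize.
by rewrite Nf opprB addrCA subrr addr0 addrK.
Qed.

Lemma canonical_map_injective n : injective (canonical_map S T n).
Proof.
move=> x y; have [u <-] := cohomology_class_surj x.
have [v <-] := cohomology_class_surj y.
rewrite /canonical_map !induced_mapE => /cohomology_class_eq E.
apply/cohomology_class_eq; move: E => /=.
have : has_growth S T (val u - val v).
  have /andP[Cu _] := valP u; have /andP[Cv _] := valP v.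
  by have /asboolP := rpredB Cu Cv.
case: n x y u v => [|n] x y u v //= gw [psi _ psiE].
have /has_growth_homogenize fg := gw.
have fE : homogenize (val u - val v) = alt_sum (homogenize psi).
  by rewrite -homogenize_cobd psiE.
have [e [ei eg] Ee] := coboundary_growth_primitive
  (invariant_homogenize _) fg (invariant_homogenize psi) fE.
exists (dehomogenize e).
  by apply/asboolP/has_growth_homogenize; rewrite dehomogenizeK.
by apply: (can_inj (@homogenizeK R G n.+1)); rewrite homogenize_cobd dehomogenizeK.
Qed.

Lemma canonical_map_surjective n y : exists x, canonical_map S T n x = y.
Proof.
have [v <-] := cohomology_class_surj y; have /andP[_ /eqP dv] := valP v.
suff [u [ug du uv]] : exists u : cochain R G n, [/\ has_growth S T u, cobd u = 0
    & @cobd_image R G (full_complex R G) n (u - val v)].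
  have uP : u \in @cocycles R G (growth_complex S T) n.
    by rewrite inE du eqxx andbT; apply/asboolP.
  exists (cohomology_class (exist _ u uP)).
  by rewrite /canonical_map induced_mapE; apply/cohomology_class_eq.
case: n y v dv => [|n] y v dv.
  exists (val v); split=> //; last by rewrite subrr.
  apply/has_growthE; have H a : exists2 C, 0 < C & forall g,
      `|val v g| <= C * \prod_(i < 0) weight a (tnth g i).
    exists (`|val v [tuple]| + 1) => [|g]; first by rewrite ltr_wpDl.
    by rewrite (tuple0 g) big_ord0 mulr1 lerDl.
  have [a Ia] := weight_index_nonempty T.
  by rewrite /dual_quantifier; case: inductive_growth => //; exists a.
have f0 : alt_sum (homogenize (val v)) = 0 by rewrite -homogenize_cobd dv.
have [f [e [fi fg ei fE]]] := cocycle_growth_representative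
  (invariant_homogenize _) f0.
exists (dehomogenize f); split.
- by apply/has_growth_homogenize; rewrite dehomogenizeK.
- apply: (can_inj (@homogenizeK R G n.+2)).
  rewrite homogenize_cobd dehomogenizeK// fE alt_sum_funD f0.
  by rewrite alt_sum_fun_alt_sum addr0.
exists (dehomogenize e) => //; apply: (can_inj (@homogenizeK R G n.+1)).
by rewrite homogenize_cobd homogenizeB !dehomogenizeK// fE addrC addKr.
Qed.

End GrowthOfCochains.

Theorem theorem7 (R : realType) (G : groupType) (S : seq G)
    (genS : generates S) (T : growth R)
    (contractible : has_bounded_contracting_homotopy S T) (n : nat) :
  bijective (canonical_map S T n).
Proof.
have [h contract] := contractible.
have [g gK] := choice (canonical_map_surjective genS contract (n := n)).
exists g => // x; exact/(canonical_map_injective genS contract)/gK.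
Qed.
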